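(* Let $n\ge 2$ and let $Z\subset\mathbb P^n$ be a smooth complete intersection of dimension $n-2$ cut out by two hypersurfaces of degree $d$, say $I_Z=(F,P)$ with $F,P$ forms of degree $d$. Let $s\ge 2$ and let $G_1,\dots,G_s\in[I_Z]_d$ be forms defining $s$ distinct smooth hypersurfaces of $\mathbb P^n$; write $G_i=a_iF+b_iP$ with $a_i,b_i\in K$. Set $G=\prod_{i=1}^s G_i$ and $J=\mathrm{Jac}(G)$. Then the saturation $J^{sat}$ is a complete intersection; in particular, $J^{top}=J^{sat}$ is arithmetically Cohen-Macaulay (ACM), and $\sqrt J=I_Z$ is ACM. More precisely, $J^{sat}=(H_1,H_2)$ is a complete intersection of type $((s-1)d,(s-1)d)$, where $$H_1=\sum_{i=1}^s a_i\frac{G}{G_i},\qquad H_2=\sum_{i=1}^s b_i\frac{G}{G_i}.$$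
   Context: $K$ is an algebraically closed field of characteristic zero, $S=K[x_0,\dots,x_n]$, $\mathfrak m=(x_0,\dots,x_n)$, and $d\ge 1$. $I_Z$ is the saturated homogeneous ideal of $Z$ and $[I_Z]_d$ its degree-$d$ component. $\mathrm{Jac}(G)=\left(\frac{\partial G}{\partial x_0},\dots,\frac{\partial G}{\partial x_n}\right)$. $J^{sat}$ is the saturation of $J$ with respect to $\mathfrak m$. $J^{top}$ is the intersection of the primary components of height two in a primary decomposition of $J$. A homogeneous saturated ideal $I$ is called ACM if $S/I$ is a Cohen-Macaulay ring. An ideal is a complete intersection of type $(a,b)$ if it is generated by a regular sequence of two forms of degrees $a$ and $b$. *)

(* Defs.v *)
From HB Require Import structures.
From mathcomp Require Import all_boot all_order all_algebra.
From mathcomp Require Import mpoly.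

Set Implicit Arguments.
Unset Strict Implicit.
Unset Printing Implicit Defensive.

Import GRing.Theory.

Local Open Scope ring_scope.

(* The ideals of ring_quotient are decidable and proper; the ideals below are
   arbitrary, hence Prop-valued, and are compared extensionally. A notion for
   a quotient ring R/I is phrased in R, through the correspondence between
   ideals of R/I and ideals of R containing I.                              *)

Section Ideals.
Variable R : comNzRingType.
Implicit Types (I J P Q M : R -> Prop) (fs : seq R).

Definition subI I J : Prop := forall x, I x -> J x.
Definition eqI I J : Prop := forall x, I x <-> J x.

Definition is_ideal I : Prop :=
  [/\ I 0, forall x y, I x -> I y -> I (x + y) & forall a x, I x -> I (a * x)].

Definition zeroI : R -> Prop := fun x => x = 0.

Definition addI I J : R -> Prop :=
  fun x => exists y z, [/\ I y, J z & x = y + z].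

Definition genI fs : R -> Prop :=
  fun x => exists c : 'I_(size fs) -> R, x = \sum_i c i * fs`_i.

Definition radicalI I : R -> Prop := fun x => exists k : nat, I (x ^+ k).

Definition is_prime P : Prop :=
  [/\ is_ideal P, ~ P 1 & forall x y, P (x * y) -> P x \/ P y].

Definition is_maximal M : Prop :=
  [/\ is_ideal M, ~ M 1 &
      forall I, is_ideal I -> subI M I -> ~ I 1 -> subI I M].

Definition is_primary Q : Prop :=
  [/\ is_ideal Q, ~ Q 1 &
      forall x y, Q (x * y) -> Q x \/ radicalI Q y].

(* p 0 < p 1 < ... < p h = P, all of them primes containing I *)
Definition prime_chain I P (h : nat) : Prop :=
  exists p : nat -> R -> Prop,
    [/\ forall i, (i <= h)%N -> is_prime (p i) /\ subI I (p i),
        forall i, (i < h)%N -> subI (p i) (p i.+1) /\ ~ subI (p i.+1) (p i)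
      & eqI (p h) P].

(* The height of Q/I in R/I, for Q containing I: the infimum, over the primes
   P containing Q, of the supremum of the lengths of the chains of primes of
   R/I ending at P/I. The height of Q in R is the case I = zeroI.           *)
Definition height_ge I Q (h : nat) : Prop :=
  forall P, is_prime P -> subI Q P -> prime_chain I P h.
Definition has_height I Q (h : nat) : Prop :=
  height_ge I Q h /\ ~ height_ge I Q h.+1.

(* the classes of fs form a regular sequence on R/I *)
Definition regular_mod I fs : Prop :=
  (forall i, (i < size fs)%N -> forall x,
     addI I (genI (take i fs)) (fs`_i * x) -> addI I (genI (take i fs)) x)
  /\ ~ addI I (genI fs) 1.

Definition regular_sequence fs : Prop := regular_mod zeroI fs.

(* the maximal length of a regular sequence on R/I contained in M/I is k *)
Definition has_depth I M (k : nat) : Prop :=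
  (exists fs, [/\ regular_mod I fs, forall f, f \in fs -> M f & size fs = k])
  /\ (forall fs, regular_mod I fs -> (forall f, f \in fs -> M f) ->
        (size fs <= k)%N).

(* R/I is Cohen-Macaulay, for R Noetherian: depth = height at each of its
   maximal ideals.                                                          *)
Definition cohen_macaulay_quot I : Prop :=
  forall M, is_maximal M -> subI I M ->
    exists k, has_depth I M k /\ has_height I M k.

Definition primary_decomposition J (r : nat) (Q : 'I_r -> R -> Prop) : Prop :=
  (forall i, is_primary (Q i)) /\ (forall x, J x <-> forall i, Q i x).

(* T = J^top, for an ideal J of height two *)
Definition is_top J T : Prop :=
  exists r (Q : 'I_r -> R -> Prop),
    primary_decomposition J Q /\
    (forall x, T x <-> forall i, has_height zeroI (Q i) 2 -> Q i x).

End Ideals.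

Section Projective.
Variables (K : fieldType) (N : nat).
Local Notation S := {mpoly K[N]}.
Implicit Types (I J : S -> Prop) (fs : seq S) (ds : seq nat).

Definition homogeneous_ideal I : Prop :=
  is_ideal I /\ forall f, I f -> forall k, I (pihomog mdeg k f).

(* Saturation with respect to (x_0, ..., x_(N-1)), whose k-th power is
   generated by the monomials of degree k.                                  *)
Definition saturation J : S -> Prop :=
  fun f => exists k, forall m : 'X_{1..N}, mdeg m = k -> J ('X_[m] * f).

Definition saturated I : Prop := subI (saturation I) I.

Definition ACM I : Prop :=
  [/\ homogeneous_ideal I, saturated I & cohen_macaulay_quot I].

Definition jacobian_ideal (G : S) : S -> Prop :=
  genI [seq G^`M(i) | i <- enum 'I_N].

Definition ci_sequence ds fs : Prop :=
  [/\ size fs = size ds, forall i, (i < size fs)%N -> fs`_i \is (nth 0%N ds i).-homog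
    & regular_sequence fs].

Definition ci_ideal ds I : Prop :=
  exists2 fs, ci_sequence ds fs & eqI I (genI fs).

(* A subset of P^(N-1) is given by the set of all (nonzero) vectors of
   homogeneous coordinates of its points.                                   *)
Definition zero_locus fs : ('I_N -> K) -> Prop :=
  fun x => (exists i, x i != 0) /\ (forall f, f \in fs -> f.@[x] = 0).

(* For K infinite and Z closed under rescaling by nonzero scalars, this is the
   homogeneous ideal of Z.                                                  *)
Definition vanishing_ideal (Z : ('I_N -> K) -> Prop) : S -> Prop :=
  fun f => forall x, Z x -> f.@[x] = 0.

Definition jacobian_mx fs (x : 'I_N -> K) : 'M[K]_(size fs, N) :=
  \matrix_(i, j) ((fs`_i)^`M(j)).@[x].

(* fs cuts out a smooth complete intersection (a smooth hypersurface when
   size fs = 1): by the Jacobian criterion, the rank is the codimension at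
   each point.                                                              *)
Definition smooth_ci ds fs : Prop :=
  ci_sequence ds fs /\
  forall x, zero_locus fs x -> \rank (jacobian_mx fs x) = size fs.

End Projective.

(* Main.v *)
(* Writing d G = H1 dF + H2 dP, the ideal of the c with c H1, c H2 in J contains
   J and the 2x2 minors of the Jacobian matrix of (F, P), so smoothness of Z and
   of the hypersurfaces leaves it no projective zero; by the Nullstellensatz it
   contains a power of the irrelevant ideal. Any prime containing H1 and H2
   contains s G = H1 F + H2 P, hence two of the G_i, hence F and P; so powers of
   F and P lie in (H1, H2), which is therefore a complete intersection.

   What remains is that a complete intersection (f, g) of codimension two is
   Cohen-Macaulay and unmixed. After two changes of variables (Nagata), f is
   monic in one variable and some r in (f, g) free of that variable is monic in
   another one; S/(f, r) is then free over the polynomial ring B in the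
   remaining variables, and S/(f, g) is flat over B by linkage. Heights are
   bounded through the growth of S/I: a chain of primes of length h ending at P
   raises the degree of growth by at least h.                                *)

From HB Require Import structures.
From Stdlib Require Import Classical ClassicalEpsilon FunctionalExtensionality PropExtensionality.
Require Import Defs.
From mathcomp Require Import all_boot all_order all_algebra.
From mathcomp Require Import mpoly.
From mathcomp Require Import ring zify.

Set Implicit Arguments.
Unset Strict Implicit.
Unset Printing Implicit Defensive.

Import GRing.Theory.

Local Open Scope ring_scope.

(** * Ideals and primes of noetherian rings *)

(** Heights quantify over all chains of primes, and two elementary tools bound them. From below: a
    prime containing a regular sequence of length k ends a chain of length k, since primes avoiding
    a nonzerodivisor can be found one step at a time. From above: linearly independent elements are
    counted in bounded degree, and each strict inclusion of primes contributes a factor t to the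
    count. Regularity of (H1, H2) is not deduced from its height either, but carried over directly
    from powers of F and P.

    Unmixedness is used in this form: an ideal contained only in primes of height at least three
    contains a nonzerodivisor modulo (f, g). Applied to colon ideals (I : h), it shows both that
    (H1, H2) is saturated and that it is the top part. The changes of variables behind it destroy
    homogeneity, which is harmless because flatness and growth do not refer to the grading.

    Characteristic zero makes s and sd invertible: s in s G = H1 F + H2 P, and sd in Euler's
    identity for G. *)

Section IdealTheory.
Variable R : comNzRingType.
Implicit Types (I J P : R -> Prop) (fs : seq R).

Lemma idl0 I : is_ideal I -> I 0. Proof. by case. Qed.
Lemma idlD I x y : is_ideal I -> I x -> I y -> I (x + y).
Proof. by case=> _ h _; apply: h. Qed.
Lemma idlMl I a x : is_ideal I -> I x -> I (a * x).
Proof. by case=> _ _; apply. Qed.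
Lemma idlMr I a x : is_ideal I -> I x -> I (x * a).
Proof. by rewrite mulrC; apply: idlMl. Qed.
Lemma idlN I x : is_ideal I -> I x -> I (- x).
Proof. by rewrite -mulN1r; apply: idlMl. Qed.
Lemma idlB I x y : is_ideal I -> I x -> I y -> I (x - y).
Proof. by move=> hI hx hy; apply: idlD => //; apply: idlN. Qed.
Lemma idl_sum I (T : Type) (r : seq T) (A : pred T) (F : T -> R) :
  is_ideal I -> (forall i, A i -> I (F i)) -> I (\sum_(i <- r | A i) F i).
Proof.
move=> hI hF; elim/big_ind: _ => //; first exact: idl0.
by move=> x y; apply: idlD.
Qed.
Lemma idlDl I x y : is_ideal I -> I x -> I (x + y) <-> I y.
Proof.
move=> hI hx; split; last exact: idlD.
by move=> h; rewrite -[y](addKr x) addrC; apply: idlB.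
Qed.

Lemma prime_ideal P : is_prime P -> is_ideal P. Proof. by case. Qed.
Lemma prime_exp P x k : is_prime P -> P (x ^+ k) -> P x.
Proof.
case=> hP h1 hM; elim: k => [|k IH]; first by rewrite expr0.
by rewrite exprS => /hM[].
Qed.

Lemma zeroI_ideal : is_ideal (@zeroI R).
Proof.
split=> [//|x y -> ->|a x ->]; first by rewrite /zeroI addr0.
by rewrite /zeroI mulr0.
Qed.

Lemma genI_ideal fs : is_ideal (genI fs).
Proof.
split=> [|x y [c ->] [c' ->]|a x [c ->]].
- by exists (fun _ => 0); rewrite big1 // => i _; rewrite mul0r.
- exists (fun i => c i + c' i); rewrite -big_split /=.
  by apply: eq_bigr => i _; rewrite mulrDl.
- by exists (fun i => a * c i); rewrite mulr_sumr; apply: eq_bigr => i _; rewrite mulrA.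
Qed.

Lemma genI_mem fs f : f \in fs -> genI fs f.
Proof.
move=> /(nthP 0)[i hi <-]; exists (fun j => (j == Ordinal hi)%:R).
rewrite (bigD1 (Ordinal hi)) //= eqxx mul1r big1 ?addr0 // => j /negPf ->.
by rewrite mul0r.
Qed.

Lemma genI_min fs I : is_ideal I -> (forall f, f \in fs -> I f) -> subI (genI fs) I.
Proof.
move=> hI h x [c ->]; apply: idl_sum => // i _; apply: idlMl => //.
by apply: h; apply: mem_nth.
Qed.

Lemma genI_sub fs gs : {subset fs <= gs} -> subI (genI fs) (genI gs).
Proof.
move=> h; apply: genI_min; first exact: genI_ideal.
by move=> f /h; apply: genI_mem.
Qed.

Lemma genI2P (f g x : R) : genI [:: f; g] x <-> exists u v, x = u * f + v * g.
Proof.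
split.
  case=> c ->; rewrite big_ord_recl big_ord1 /=.
  by exists (c ord0), (c (lift ord0 ord0)).
case=> u [v ->]; apply: idlD; first exact: genI_ideal.
  by apply: idlMl; [exact: genI_ideal | apply: genI_mem; rewrite inE eqxx].
by apply: idlMl; [exact: genI_ideal | apply: genI_mem; rewrite !inE eqxx orbT].
Qed.

Lemma genI1P (f x : R) : genI [:: f] x <-> exists u, x = u * f.
Proof.
split; first by case=> c ->; rewrite big_ord1 /=; exists (c ord0).
by case=> u ->; apply: idlMl; [exact: genI_ideal | apply: genI_mem; rewrite inE].
Qed.

Lemma genI0P (x : R) : genI [::] x <-> x = 0.
Proof.
split; first by case=> c ->; rewrite big_ord0.
by move=> ->; apply: idl0; apply: genI_ideal.
Qed.

Lemma addI_ideal I J : is_ideal I -> is_ideal J -> is_ideal (addI I J).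
Proof.
move=> hI hJ; split.
- by exists 0, 0; split; [exact: idl0|exact: idl0|rewrite addr0].
- move=> x x' [y [z [hy hz ->]]] [y' [z' [hy' hz' ->]]].
  by exists (y + y'), (z + z'); split; [exact: idlD|exact: idlD|ring].
- move=> a x [y [z [hy hz ->]]].
  by exists (a * y), (a * z); split; [exact: idlMl|exact: idlMl|ring].
Qed.

Lemma addI_left I J : is_ideal J -> subI I (addI I J).
Proof. by move=> hJ x hx; exists x, 0; split=> //; [exact: idl0|rewrite addr0]. Qed.
Lemma addI_right I J : is_ideal I -> subI J (addI I J).
Proof. by move=> hI x hx; exists 0, x; split=> //; [exact: idl0|rewrite add0r]. Qed.
Lemma addI_min I J L : is_ideal L -> subI I L -> subI J L -> subI (addI I J) L.
Proof. by move=> hL h h' x [y [z [hy hz ->]]]; apply: idlD; auto. Qed.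

Lemma addI_mono I J I' J' : subI I I' -> subI J J' -> subI (addI I J) (addI I' J').
Proof. by move=> h h' x [y [z [hy hz ->]]]; exists y, z; split; auto. Qed.

Definition nzd_mod I (x : R) : Prop := forall y, I (x * y) -> I y.

Lemma addI_zeroI I : is_ideal I -> eqI (addI (@zeroI R) I) I.
Proof.
move=> hI x; split; last by apply: addI_right; apply: zeroI_ideal.
by case=> y [z [-> hz ->]]; rewrite add0r.
Qed.

Lemma regular_sequence2P (f g : R) : regular_sequence [:: f; g] <->
  [/\ nzd_mod (@zeroI R) f, nzd_mod (genI [:: f]) g & ~ genI [:: f; g] 1].
Proof.
have e0 x : addI (@zeroI R) (genI [::]) x <-> zeroI x.
  by rewrite (addI_zeroI (genI_ideal _)) genI0P.
have e fs x : addI (@zeroI R) (genI fs) x <-> genI fs x.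
  exact: (addI_zeroI (genI_ideal _)).
split=> [[reg n1]|[h1 h2 h3]]; [split|split].
- by move=> y hy; apply/e0; apply: (reg 0%N) => //; apply/e0.
- by move=> y hy; apply/(e [:: f]); apply: (reg 1%N) => //; apply/(e [:: f]).
- by move=> h; apply: n1; apply/e.
- by case=> [|[|//]] _ x /= => [/e0/h1/e0//|/e/h2/e].
- by move/e.
Qed.

Definition colonI I (y : R) : R -> Prop := fun x => I (x * y).

Lemma colonI_ideal I y : is_ideal I -> is_ideal (colonI I y).
Proof.
move=> hI; split; rewrite /colonI; first by rewrite mul0r; apply: idl0.
- by move=> x z hx hz; rewrite mulrDl; apply: idlD.
- by move=> a x hx; rewrite -mulrA; apply: idlMl.
Qed.

Lemma nzd_modX I x k : nzd_mod I x -> nzd_mod I (x ^+ k).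
Proof.
move=> h; elim: k => [|k IH] y; first by rewrite expr0 mul1r.
by rewrite exprS -mulrA => /h /IH.
Qed.

Definition spanI (E : R -> Prop) : R -> Prop :=
  fun x => forall I, is_ideal I -> subI E I -> I x.

Lemma spanI_ideal E : is_ideal (spanI E).
Proof.
split=> [I hI _|x y hx hy I hI hE|a x hx I hI hE].
- exact: idl0.
- by apply: idlD => //; [exact: hx|exact: hy].
- by apply: idlMl => //; exact: hx.
Qed.

Lemma spanI_mem E : subI E (spanI E).
Proof. by move=> x hx I _; apply. Qed.
Lemma spanI_min E I : is_ideal I -> subI E I -> subI (spanI E) I.
Proof. by move=> hI hE x; apply. Qed.

Definition noetherian := forall I, is_ideal I -> exists fs, eqI I (genI fs).

Section Noetherian.
Hypothesis noeth : noetherian.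

Lemma noetherian_union (C : nat -> R -> Prop) :
  (forall k, is_ideal (C k)) -> (forall k, subI (C k) (C k.+1)) ->
  exists k, forall l, subI (C l) (C k).
Proof.
move=> hC hS.
have mono k l : (k <= l)%N -> subI (C k) (C l).
  move=> /subnKC <-; elim: (l - k)%N => [|m IH] x; first by rewrite addn0.
  by rewrite addnS => /IH; apply: hS.
pose U x := exists k, C k x.
have hU : is_ideal U.
  split; first by exists 0%N; apply: idl0.
  - move=> x y [k hk] [l hl]; exists (maxn k l); apply: idlD => //.
      by apply: mono hk; apply: leq_maxl.
    by apply: mono hl; apply: leq_maxr.
  - by move=> a x [k hk]; exists k; apply: idlMl.
have [fs hfs] := noeth hU.
have [k hk] : exists k, forall f, f \in fs -> C k f.
  have : forall f, f \in fs -> U f by move=> f hf; apply/hfs/genI_mem.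
  elim: (fs) => [|f gs IH] h; first by exists 0%N.
  have [k hk] := h f (mem_head _ _).
  have [|l hl] := IH; first by move=> g hg; apply: h; rewrite inE hg orbT.
  exists (maxn k l) => g; rewrite inE => /orP[/eqP->|hg].
    by apply: mono hk; apply: leq_maxl.
  by apply: mono (hl _ hg); apply: leq_maxr.
exists k => l x hx; apply: (genI_min (hC k) hk).
by apply/hfs; exists l.
Qed.

(** A failing ideal would have a strictly larger failing ideal; choice strings these into an
    ascending chain that never stops. *)
Lemma noetherian_ind (A : (R -> Prop) -> Prop) :
  (forall I, is_ideal I ->
     (forall I', is_ideal I' -> subI I I' -> ~ subI I' I -> A I') -> A I) ->
  forall I, is_ideal I -> A I.
Proof.
move=> ih I0 hI0; apply: NNPP => nA.
pose T := {I : R -> Prop | is_ideal I /\ ~ A I}.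
have next (t : T) : {t' : T | subI (proj1_sig t) (proj1_sig t') /\
    ~ subI (proj1_sig t') (proj1_sig t)}.
  apply: constructive_indefinite_description.
  case: t => I [hI nI] /=; apply: NNPP => hn; apply: nI; apply: ih => // I' hI' h1 h2.
  apply: NNPP => nI'; apply: hn.
  by exists (exist _ I' (conj hI' nI')).
pose C k := proj1_sig (iter k (fun t => proj1_sig (next t)) (exist _ I0 (conj hI0 nA) : T)).
have hC k : is_ideal (C k) by rewrite /C; case: (iter _ _ _) => ? [].
have hS k : subI (C k) (C k.+1) by rewrite /C /=; case: (next _) => ? [].
have [k hk] := noetherian_union hC hS.
have : ~ subI (C k.+1) (C k) by rewrite /C /=; case: (next _) => ? [].
by apply; apply: hk.
Qed.

Lemma addI_principal_strict I x : is_ideal I -> ~ I x ->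
  [/\ is_ideal (addI I (genI [:: x])), subI I (addI I (genI [:: x]))
    & ~ subI (addI I (genI [:: x])) I].
Proof.
move=> hI nx; split.
- by apply: addI_ideal => //; apply: genI_ideal.
- by apply: addI_left; apply: genI_ideal.
- by move=> h; apply: nx; apply: h; apply: addI_right => //; apply: genI_mem; rewrite inE.
Qed.

(** Noetherian induction takes the place of Zorn's lemma. If [x * y] is in [I] but [x] and [y] are
    not, one of [I + (x)], [I + (y)] still misses [M]: otherwise an element of [M] from each would
    have its product in both [M] and [I]. *)
Lemma prime_avoiding (M : R -> Prop) I :
  M 1 -> (forall x y, M x -> M y -> M (x * y)) -> is_ideal I ->
  (forall x, M x -> ~ I x) ->
  exists p, [/\ is_prime p, subI I p & forall x, M x -> ~ p x].
Proof.
move=> M1 MM; elim/noetherian_ind; move=> {}I hI IH hd.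
case: (classic (is_prime I)) => [pI|npI]; first by exists I; split.
have [x [y [hxy nx ny]]] : exists x y, [/\ I (x * y), ~ I x & ~ I y].
  apply: NNPP => h; apply: npI; split=> //; first exact: hd.
  move=> x y hxy; case: (classic (I x)) => hx; first by left.
  case: (classic (I y)) => hy; first by right.
  by case: h; exists x, y.
have larger z : ~ I z -> (forall m, M m -> ~ addI I (genI [:: z]) m) ->
    exists p, [/\ is_prime p, subI I p & forall x, M x -> ~ p x].
  move=> nz hz; have [h1 h2 h3] := addI_principal_strict hI nz.
  have [p [hp1 hp2 hp3]] := IH _ h1 h2 h3 hz.
  by exists p; split=> // t ht; apply: hp2; apply: h2.
have meets z : ~ (forall m, M m -> ~ addI I (genI [:: z]) m) ->
    exists i a, I i /\ M (i + a * z).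
  move=> h; apply: NNPP => hn; apply: h => m Mm [i [w [hi /genI1P[a ->] e]]].
  by apply: hn; exists i, a; rewrite -e.
case: (classic (forall m, M m -> ~ addI I (genI [:: x]) m)) => [/(larger _ nx)//|].
case/meets => i [a [hi Mx]].
case: (classic (forall m, M m -> ~ addI I (genI [:: y]) m)) => [/(larger _ ny)//|].
case/meets => j [b [hj My]].
case: (hd _ (MM _ _ Mx My)).
have -> : (i + a * x) * (j + b * y) = (j + b * y) * i + (a * x * j + a * b * (x * y)) by ring.
by do 2?[apply: idlD => //]; apply: idlMl.
Qed.

(** Localization at [p] and at [z], without fractions: the products [u * z ^ k] with [u] outside [p]
    form a multiplicative set, which misses [I] because [z] is regular modulo [I]. *)
Lemma prime_below I p z : is_ideal I -> is_prime p -> subI I p -> nzd_mod I z ->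
  exists q, [/\ is_prime q, subI I q, subI q p & ~ q z].
Proof.
move=> hI hp hIp hz.
pose M x := exists u k, ~ p u /\ x = u * z ^+ k.
have [|||q [hq h1 h2]] := prime_avoiding (M := M) _ _ hI.
- exists 1, 0%N; split; last by rewrite expr0 mulr1.
  by case: hp.
- move=> _ _ [u [k [hu ->]]] [v [l [hv ->]]]; exists (u * v), (k + l)%N.
  split; last by rewrite exprD; ring.
  by case: hp => _ _ hM /hM[].
- move=> _ [u [k [hu ->]]]; rewrite mulrC => /(nzd_modX hz) /hIp.
  exact: hu.
exists q; split=> // [x hx|hqz].
  by apply: NNPP => nx; apply: (h2 x) => //; exists x, 0%N; rewrite expr0 mulr1.
apply: (h2 z) => //; exists 1, 1%N; split; last by rewrite mul1r expr1.
by case: hp.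
Qed.

Lemma regular_mod_rcons I fs z : is_ideal I -> regular_mod I (rcons fs z) ->
  regular_mod I fs /\ nzd_mod (addI I (genI fs)) z.
Proof.
move=> hI [h n1]; split; last first.
  move=> y hy; have := h (size fs); rewrite size_rcons leqnn => /(_ isT y).
  by rewrite -cats1 take_size_cat // nth_cat ltnn subnn; apply.
split=> [i hi x|].
  have := h i; rewrite size_rcons ltnS => /(_ (ltnW hi) x).
  by rewrite nth_rcons hi -cats1 takel_cat // ltnW.
move=> hh; apply: n1; apply: addI_mono hh => //.
by apply: genI_sub => f; rewrite mem_rcons inE orbC => ->.
Qed.

(** The last element [z] lies in [p] but is regular modulo the previous ones, so some prime below
    [p] contains those and omits [z]: the top inclusion is strict. Besides bounding heights from
    below, this turns bounds on chains into bounds on depth. *)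
Lemma prime_chain_regular I p fs : is_ideal I -> regular_mod I fs -> is_prime p ->
  subI I p -> (forall f, f \in fs -> p f) -> prime_chain I p (size fs).
Proof.
move=> hI; elim/last_ind: fs p => [|fs z IH] p hreg hp hIp hfs.
  by exists (fun _ => p); split.
have [hreg' hz] := regular_mod_rcons hI hreg.
have hI' := addI_ideal hI (genI_ideal fs).
have [|q [hq h1 h2 h3]] := prime_below hI' hp _ hz.
  apply: addI_min => //; first exact: prime_ideal.
  apply: genI_min; first exact: prime_ideal.
  by move=> f hf; apply: hfs; rewrite mem_rcons inE hf orbT.
have [||||c [hc1 hc2 hc3]] := IH q => //.
- by move=> x hx; apply: h1; apply: addI_left hx; apply: genI_ideal.
- by move=> f hf; apply: h1; apply: addI_right => //; apply: genI_mem.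
exists (fun i => if (i <= size fs)%N then c i else p); rewrite size_rcons; split.
- by move=> i _; case: ifP => [/hc1|].
- move=> i; rewrite ltnS => hi; rewrite hi.
  case: ltnP => [/hc2 //|hi'].
  have -> : i = size fs by apply/eqP; rewrite eqn_leq hi.
  split; first by move=> x /hc3 /h2.
  move=> h; apply: h3; apply/hc3; apply: h; apply: hfs.
  by rewrite mem_rcons mem_head.
- by rewrite ltnn.
Qed.

(** Noether's argument: if [x * y] is in [J], with [x] outside [J] and no power of [y] in it, the
    colon ideals by powers of [y] become stationary at some [k], and [J] is the intersection of the
    larger ideals [(J : y ^ k)] and [J + (y ^ k)]. *)
Lemma primary_decomposition_exists J : is_ideal J ->
  exists r (Q : 'I_r -> R -> Prop), primary_decomposition J Q.
Proof.
elim/noetherian_ind; move=> {}J hJ IH.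
case: (classic (J 1)) => [J1|nJ1].
  exists 0%N, (fun _ => J); split=> [[]//|x]; split=> [_ []//|_].
  by rewrite -[x]mulr1; apply: idlMl.
case: (classic (is_primary J)) => [pJ|npJ].
  by exists 1%N, (fun _ => J); split=> // x; split=> // h; apply: (h ord0).
have [x [y [hxy nx ny]]] : exists x y, [/\ J (x * y), ~ J x & ~ radicalI J y].
  apply: NNPP => h; apply: npJ; split=> // x y hxy.
  case: (classic (J x)) => hx; first by left.
  case: (classic (radicalI J y)) => hy; first by right.
  by case: h; exists x, y.
have [k hk] : exists k, forall l, subI (colonI J (y ^+ l)) (colonI J (y ^+ k)).
  apply: noetherian_union => [k|k z]; first exact: colonI_ideal.
  by rewrite /colonI exprS => h; rewrite mulrCA; apply: idlMl.
pose J1 := colonI J (y ^+ k); pose J2 := addI J (genI [:: y ^+ k]).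
have hx1 : J1 x by apply: (hk 1%N); rewrite /colonI expr1.
have hJ1 : is_ideal J1 by apply: colonI_ideal.
have sJ1 : subI J J1 by move=> z hz; apply: idlMr.
have [|r1 [Q1 [p1 e1]]] := IH _ hJ1 sJ1; first by move=> h; apply: nx; apply: h.
have nyk : ~ J (y ^+ k) by move=> h; apply: ny; exists k.
have [h1 h2 h3] := addI_principal_strict hJ nyk.
have [r2 [Q2 [p2 e2]]] := IH _ h1 h2 h3.
exists (r1 + r2)%N, (fun i => match split i with inl a => Q1 a | inr b => Q2 b end).
split; first by move=> i; case: split.
move=> z; split=> [hz i|hz].
  by case: split => j; [apply: (proj1 (e1 z)); apply: sJ1 | apply: (proj1 (e2 z)); apply: h2].
have /e1 : forall i, Q1 i z by move=> i; have := hz (lshift r2 i); rewrite (unsplitK (inl i)).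
have /e2 : forall i, Q2 i z by move=> i; have := hz (rshift r1 i); rewrite (unsplitK (inr i)).
(* An element of both ideals is [j + a * y ^ k]; multiplied by [y ^ k] it shows that
   [a * y ^ (k + k)] is in [J], and stationarity brings the exponent back to [k]. *)
case=> j [w [hj /genI1P[a ->] ->]] hh; apply: idlD => //.
have /hk : colonI J (y ^+ (k + k)) a.
  rewrite /colonI exprD; move: hh; rewrite /J1 /colonI mulrDl.
  move=> /(idlDl _ hJ) h; rewrite mulrA; apply/h.
  exact: idlMr.
by [].
Qed.

End Noetherian.
End IdealTheory.

(** * Hilbert's basis theorem and Noether position *)

Lemma noetherian_surj (A B : comNzRingType) (phi : {rmorphism B -> A}) (g : A -> B) :
  cancel g phi -> noetherian B -> noetherian A.
Proof.
move=> gK nB I hI.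
have [|fs hfs] := nB (fun b => I (phi b)).
  split; first by rewrite rmorph0; apply: idl0.
  - by move=> x y hx hy; rewrite rmorphD; apply: idlD.
  - by move=> a x hx; rewrite rmorphM; apply: idlMl.
exists (map phi fs) => x; split.
  rewrite -[x]gK => /hfs[c ->]; rewrite rmorph_sum.
  apply: idl_sum => [|i _]; first exact: genI_ideal.
  rewrite rmorphM; apply: idlMl; first exact: genI_ideal.
  by apply: genI_mem; apply: map_f; apply: mem_nth.
apply: genI_min => // _ /mapP[f hf ->].
by apply/hfs; apply: genI_mem.
Qed.

Lemma noetherian_field (K : fieldType) : noetherian K.
Proof.
move=> I hI; case: (classic (exists2 x, I x & x != 0)) => [[x hx nx]|h].
  exists [:: x] => y; split.
    by move=> _; apply/genI1P; exists (y / x); rewrite mulfVK.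
  by case/genI1P => u ->; apply: idlMl.
exists [::] => y; rewrite genI0P; split; last by move=> ->; apply: idl0.
by move=> hy; apply/eqP/negPn/negP => ny; apply: h; exists y.
Qed.

Section HilbertBasis.
Variable R : comNzRingType.
Implicit Types (p q : {poly R}) (I : {poly R} -> Prop).

Lemma size_le_leadcoef0 p k : (size p <= k.+1)%N -> p`_k = 0 -> (size p <= k)%N.
Proof.
move=> h h0; apply/leq_sizeP => j; rewrite leq_eqVlt => /orP[/eqP<- //|hj].
by rewrite nth_default // (leq_trans h).
Qed.

Let leadI I (k : nat) : R -> Prop :=
  fun a => exists p, [/\ I p, (size p <= k.+1)%N & p`_k = a].

Let leadI_ideal I k : is_ideal I -> is_ideal (leadI I k).
Proof.
move=> hI; split.
- by exists 0; rewrite size_poly0 coef0; split=> //; apply: idl0.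
- move=> _ _ [p [hp sp <-]] [q [hq sq <-]]; exists (p + q); split; last by rewrite coefD.
    exact: idlD.
  by apply: leq_trans (size_polyD _ _) _; rewrite geq_max sp.
- move=> a _ [p [hp sp <-]]; exists (a%:P * p); split; last by rewrite coefCM.
    exact: idlMl.
  by rewrite mul_polyC; apply: leq_trans (size_scale_leq _ _) _.
Qed.

(** The ideals of leading coefficients increase with the degree, hence stabilize at some [k].
    Elements of degree at most [k] are handled by induction on the degree; a longer one loses its
    leading term to a shifted element of degree [k]. *)
Theorem hilbert_basis : noetherian R -> noetherian {poly R}.
Proof.
move=> nR I hI.
have low k : exists ps : seq {poly R}, (forall p, p \in ps -> I p) /\
    forall p, I p -> (size p <= k)%N -> genI ps p.
  elim: k => [|k [ps [hps1 hps2]]].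
    exists [::]; split=> // p _; rewrite leqn0 size_poly_eq0 => /eqP->.
    by apply: idl0; apply: genI_ideal.
  have [gs hgs] := nR _ (leadI_ideal k hI).
  have [qs [hqs1 hqs2]] : exists qs : seq {poly R}, (forall q, q \in qs -> I q) /\
      forall a, a \in gs -> exists q, [/\ q \in qs, (size q <= k.+1)%N & q`_k = a].
    have : forall a, a \in gs -> leadI I k a by move=> a ha; apply/hgs/genI_mem.
    elim: (gs) => [|a as_ IH] h; first by exists [::].
    have [|qs [h1 h2]] := IH; first by move=> b hb; apply: h; rewrite inE hb orbT.
    have [q [hq sq cq]] := h a (mem_head _ _).
    exists (q :: qs); split; first by move=> p; rewrite inE => /orP[/eqP->|/h1].
    move=> b; rewrite inE => /orP[/eqP->|/h2[p [hp sp cp]]].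
      by exists q; rewrite mem_head.
    by exists p; rewrite inE hp orbT.
  exists (qs ++ ps); split.
    by move=> p; rewrite mem_cat => /orP[/hqs1|/hps1].
  move=> p hp sp.
  have [q [hq1 hq2 hq3 hq4]] : exists q, [/\ genI qs q, I q, (size q <= k.+1)%N & q`_k = p`_k].
    have : genI gs p`_k by apply/hgs; exists p.
    pose L a := exists q, [/\ genI qs q, I q, (size q <= k.+1)%N & q`_k = a].
    have hL : is_ideal L.
      have hG := genI_ideal qs; split.
      - by exists 0; rewrite size_poly0 coef0; split=> //; apply: idl0.
      - move=> _ _ [q [hq1 hq2 sq <-]] [r [hr1 hr2 sr <-]]; exists (q + r).
        split; [exact: idlD|exact: idlD| |by rewrite coefD].
        by apply: leq_trans (size_polyD _ _) _; rewrite geq_max sq.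
      - move=> a _ [q [hq1 hq2 sq <-]]; exists (a%:P * q).
        split; [exact: idlMl|exact: idlMl| |by rewrite coefCM].
        by rewrite mul_polyC; apply: leq_trans (size_scale_leq _ _) _.
    apply: (genI_min hL) => a /hqs2[q [hq sq cq]]; exists q; split=> //.
      exact: genI_mem.
    exact: hqs1.
  rewrite -[p](subrK q); apply: idlD; first exact: genI_ideal.
    apply: (@genI_sub _ ps) => [x|]; first by rewrite mem_cat orbC => ->.
    apply: hps2; first exact: idlB.
    apply: size_le_leadcoef0; last by rewrite coefB hq4 subrr.
    by apply: leq_trans (size_polyD _ _) _; rewrite size_polyN geq_max sp.
  by apply: (@genI_sub _ qs) hq1 => x; rewrite mem_cat => ->.
have [|k hk] := noetherian_union nR (fun k => leadI_ideal k hI).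
  move=> k a [p [hp sp <-]]; exists ('X * p); rewrite coefXM; split=> //.
    exact: idlMl.
  by apply: leq_trans (size_polyMleq _ _) _; rewrite size_polyX.
have [ps [hps1 hps2]] := low k.+1.
exists ps => p; split; last exact: genI_min.
have [n] := ubnP (size p); elim: n p => // n IH p; rewrite ltnS => sp hp.
case: (leqP (size p) k.+1) => hsp; first exact: hps2.
have [q [hq sq cq]] : leadI I k (lead_coef p).
  by apply: (hk (size p).-1); exists p; split=> //; apply: leqSpred.
have hqp := hps2 q hq sq.
rewrite -[p](subrK ('X^((size p).-1 - k) * q)).
have e : (size p).-1 = ((size p).-1 - k + k)%N.
  by rewrite subnK // -ltnS prednK // (leq_trans _ hsp).
have sp0 : (0 < size p)%N by rewrite (leq_trans _ hsp).
apply: idlD; [exact: genI_ideal| |by apply: idlMl => //; exact: genI_ideal].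
apply: IH; last by apply: idlB => //; apply: idlMl.
apply: leq_trans sp; rewrite -[X in (_ < X)%N](prednK sp0) ltnS.
apply: size_le_leadcoef0; last first.
  by rewrite coefB coefXnM ltnNge leq_subr /= subKn ?cq ?subrr // -ltnS prednK // (leq_trans _ hsp).
apply: leq_trans (size_polyD _ _) _; rewrite size_polyN geq_max prednK // leqnn /=.
apply: leq_trans (size_polyMleq _ _) _; rewrite size_polyXn /=.
by rewrite -{2}(prednK sp0) {2}e -addnS leq_add2l.
Qed.
End HilbertBasis.

Lemma mpoly_rmorphism_ext n (R S : comNzRingType) (f g : {rmorphism {mpoly R[n]} -> S}) :
  (forall c, f c%:MP = g c%:MP) -> (forall i, f 'X_i = g 'X_i) -> f =1 g.
Proof.
move=> hC hX p; rewrite [p]mpolyE !rmorph_sum; apply: eq_bigr => m _.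
rewrite -mul_mpolyC !rmorphM hC mpolyXE_id !rmorph_prod; congr (_ * _).
by apply: eq_bigr => i _; rewrite !rmorphXn hX.
Qed.

Lemma poly_rmorphism_ext (R S : comNzRingType) (f g : {rmorphism {poly R} -> S}) :
  (forall c, f c%:P = g c%:P) -> f 'X = g 'X -> f =1 g.
Proof.
move=> hC hX p; rewrite -[p]coefK poly_def !rmorph_sum; apply: eq_bigr => i _.
by rewrite -mul_polyC !rmorphM !rmorphXn hC hX.
Qed.

Section Nagata.
Variables (K : fieldType) (m e : nat).
Local Notation A := {mpoly K[m]}.
Local Notation S := {mpoly K[m.+1]}.

(** The variable of index [i] gets degree [e ^ i], including ['X] with [e ^ 0], so that the
    exponents of a monomial become the base [e] digits of the degree of its image. *)
Definition nagata_var (i : 'I_m.+1) : {poly A} :=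
  if unlift ord0 i is Some j then ('X_j)%:P + 'X^(e ^ i) else 'X.

Definition nagata : S -> {poly A} := mmap (polyC \o @mpolyC m K) nagata_var.
HB.instance Definition _ := GRing.RMorphism.on nagata.

Definition nagata_inv_coef : A -> S :=
  mmap (@mpolyC m.+1 K) (fun j => 'X_(lift ord0 j) - 'X_ord0 ^+ (e ^ j.+1)).
HB.instance Definition _ := GRing.RMorphism.on nagata_inv_coef.

Lemma nagata_inv_comm : commr_rmorph nagata_inv_coef 'X_ord0.
Proof. by move=> x; apply: mulrC. Qed.

Definition nagata_inv : {poly A} -> S := horner_morph nagata_inv_comm.
HB.instance Definition _ := GRing.RMorphism.on nagata_inv.

Lemma nagataC c : nagata c%:MP = (c%:MP)%:P.
Proof. by rewrite /nagata mmapC. Qed.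

Lemma nagataX i : nagata 'X_i = nagata_var i.
Proof. by rewrite /nagata mmapX mmap1U. Qed.

Lemma nagata_invC a : nagata_inv a%:P = nagata_inv_coef a.
Proof. by rewrite /nagata_inv horner_morphC. Qed.

Lemma nagata_invX : nagata_inv 'X = 'X_ord0.
Proof. by rewrite /nagata_inv horner_morphX. Qed.

Lemma nagata_inv_coefX j :
  nagata_inv_coef 'X_j = 'X_(lift ord0 j) - 'X_ord0 ^+ (e ^ j.+1).
Proof. by rewrite /nagata_inv_coef mmapX mmap1U. Qed.

Lemma nagataK : cancel nagata nagata_inv.
Proof.
apply: (mpoly_rmorphism_ext (f := nagata_inv \o nagata) (g := idfun)) => [c|i] /=.
  by rewrite nagataC nagata_invC /nagata_inv_coef mmapC.
rewrite nagataX /nagata_var; case: unliftP => [j|] ->; last exact: nagata_invX.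
by rewrite rmorphD rmorphXn /= nagata_invC nagata_invX nagata_inv_coefX subrK.
Qed.

Lemma nagata_invK : cancel nagata_inv nagata.
Proof.
apply: (poly_rmorphism_ext (f := nagata \o nagata_inv) (g := idfun)) => [a|] /=; last first.
  by rewrite nagata_invX nagataX /nagata_var unlift_none.
rewrite nagata_invC.
apply: (mpoly_rmorphism_ext (f := nagata \o nagata_inv_coef) (g := polyC)) => [c|j] /=.
  by rewrite /nagata_inv_coef mmapC nagataC.
rewrite nagata_inv_coefX rmorphB rmorphXn /= !nagataX /nagata_var liftK unlift_none.
by rewrite addrK.
Qed.

Definition nagata_weight (k : 'X_{1..m.+1}) := (\sum_i k i * e ^ i)%N.

(* For exponents below [e], the monomials thus go to monic polynomials of
   pairwise distinct degrees.                                               *)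
Lemma nagata_monom (k : 'X_{1..m.+1}) : (0 < e)%N ->
  nagata 'X_[k] \is monic /\ size (nagata 'X_[k]) = (nagata_weight k).+1.
Proof.
move=> e0; rewrite /nagata mmapX /mmap1 /nagata_weight.
have var i : nagata_var i \is monic /\ size (nagata_var i) = (e ^ i).+1.
  rewrite /nagata_var; case: unliftP => [j|] ->; last by rewrite monicX size_polyX.
  have h : (size (('X_j)%:P : {poly A}) < size ('X^(e ^ lift ord0 j) : {poly A}))%N.
    by rewrite size_polyXn; apply: leq_ltn_trans (size_polyC_leq1 _) _; rewrite ltnS expn_gt0 e0.
  split; last by rewrite addrC size_polyDl // size_polyXn.
  by rewrite monicE addrC lead_coefDl // lead_coefXn.
have pow i : nagata_var i ^+ k i \is monic /\
    size (nagata_var i ^+ k i) = (k i * e ^ i).+1.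
  have [h1 h2] := var i; split; first exact: monic_exp.
  have := size_exp (nagata_var i) (k i); rewrite h2 /= mulnC => <-.
  by rewrite prednK // size_poly_gt0 monic_neq0 // monic_exp.
elim/big_rec2: _ => [|i p y _ [h1 h2]]; first by rewrite monic1 size_poly1.
have [h3 h4] := pow i; split; first by rewrite monicMl.
by rewrite size_monicM ?monic_neq0 // h2 h4 addnS addSn.
Qed.

Lemma base_expansion_inj (b n : nat) (x y : 'I_n -> nat) :
  (forall i, x i < b)%N -> (forall i, y i < b)%N ->
  (\sum_i x i * b ^ i = \sum_i y i * b ^ i)%N -> x =1 y.
Proof.
elim: n x y => [|n IH] x y hx hy; first by move=> _ [].
have hb : (0 < b)%N by apply: leq_ltn_trans (hx ord0).
rewrite !big_ord_recl !expn0 !muln1.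
have shift (z : 'I_n.+1 -> nat) : (\sum_(i < n) z (lift ord0 i) * b ^ lift ord0 i =
    (\sum_(i < n) z (lift ord0 i) * b ^ i) * b)%N.
  by rewrite big_distrl /=; apply: eq_bigr => i _; rewrite -mulnA -expnSr.
rewrite !shift => h.
have h0 : x ord0 = y ord0.
  have := congr1 (modn^~ b) h.
  by rewrite ![(_ ord0 + _)%N]addnC !modnMDl !modn_small.
have h1 := IH (fun i => x (lift ord0 i)) (fun i => y (lift ord0 i)).
move: h; rewrite h0 => /addnI /eqP; rewrite eqn_pmul2r // => /eqP /h1 h2 i.
by case: (unliftP ord0 i) => [j|] -> //; apply: h2.
Qed.
End Nagata.

Lemma lead_coef_distinct_sum (R : comNzRingType) (T : eqType) (s : seq T)
    (q : T -> {poly R}) (c : T -> R) :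
  s != [::] -> uniq s -> (forall t, t \in s -> q t \is monic /\ c t != 0) ->
  {in s &, injective (fun t => size (q t))} ->
  exists2 t, t \in s & size (\sum_(t <- s) c t *: q t) = size (q t) /\
                       lead_coef (\sum_(t <- s) c t *: q t) = c t.
Proof.
have one t : q t \is monic -> c t != 0 ->
    size (c t *: q t) = size (q t) /\ lead_coef (c t *: q t) = c t.
  move=> h1 h2; have h : lead_coef (q t) = 1 by apply/eqP; rewrite -monicE.
  split; last by rewrite -mul_polyC lead_coef_proper_mul ?lead_coefC h mulr1.
  rewrite -mul_polyC size_proper_mul ?lead_coefC ?h ?mulr1 //.
  by rewrite size_polyC h2.
elim: s => [//|t s IH] _ /= /andP[nt us] hs inj.
have [h1 h2] := hs t (mem_head _ _); have [o1 o2] := one t h1 h2.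
rewrite big_cons; case: (eqVneq s [::]) => [->|ns].
  by exists t; rewrite ?mem_head // big_nil addr0.
have [||u hu [su lu]] := IH ns us.
- by move=> v hv; apply: hs; rewrite inE hv orbT.
- by move=> v w hv hw; apply: inj; rewrite inE ?hv ?hw orbT.
have tu : t != u by apply: contraNneq nt => ->.
have : size (q t) != size (q u).
  apply: contra tu => /eqP h; apply/eqP; apply: inj h; rewrite inE ?eqxx //.
  by rewrite hu orbT.
rewrite neq_ltn => /orP[h|h].
  exists u; first by rewrite inE hu orbT.
  by rewrite addrC size_polyDl ?lead_coefDl ?su ?o1 //.
exists t; first by rewrite mem_head.
by rewrite size_polyDl ?lead_coefDl ?su ?o1 //.
Qed.

Lemma noether_position (K : fieldType) m (p : {mpoly K[m.+1]}) : p != 0 ->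
  exists e c, c != 0 /\ nagata e (c *: p) \is monic.
Proof.
(* [msize p] is the degree plus one, so it exceeds every exponent occurring in [p]. *)
move=> np; pose e := msize p.
have e0 : (0 < e)%N by rewrite lt0n mmeasure_poly_eq0.
have [||||k hk [_ lk]] := @lead_coef_distinct_sum {mpoly K[m]} _ (msupp p)
   (fun k => nagata e 'X_[k]) (fun k => (p@_k)%:MP).
- by rewrite msupp_eq0.
- exact: msupp_uniq.
- move=> k; rewrite mcoeff_msupp => hk; rewrite mpolyC_eq0 hk.
  by have [] := nagata_monom K k e0.
- move=> k l hk hl h.
  have [_ ek] := nagata_monom K k e0; have [_ el] := nagata_monom K l e0.
  case: (etrans (esym ek) (etrans h el)) => {}h; apply/mnmP; apply: base_expansion_inj h => i.
    by apply: leq_ltn_trans (msize_mdeg_lt hk); rewrite mdegE (bigD1 i) //= leq_addr.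
  by apply: leq_ltn_trans (msize_mdeg_lt hl); rewrite mdegE (bigD1 i) //= leq_addr.
have lp : lead_coef (nagata e p) = (p@_k)%:MP.
  rewrite -lk {1}[p]mpolyE rmorph_sum /=; congr lead_coef; apply: eq_bigr => l _.
  by rewrite -mul_mpolyC rmorphM /= nagataC mul_polyC.
have pk : p@_k != 0 by rewrite -mcoeff_msupp.
exists e, (p@_k)^-1; split; first by rewrite invr_eq0.
rewrite -mul_mpolyC rmorphM /= nagataC monicE lead_coef_proper_mul ?lp lead_coefC -mpolyCM mulVf ?oner_eq0 //.
Qed.

Lemma mpoly_noetherian (K : fieldType) n : noetherian {mpoly K[n]}.
Proof.
elim: n => [|n IH].
  apply: (noetherian_surj (phi := @mpolyC 0 K) (g := mcoeff 0%MM)) (@noetherian_field K).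
  move=> p; apply/mpolyP => k; rewrite mcoeffC.
  have -> : k = 0%MM by apply/mnmP => [[]].
  by rewrite eqxx mulr1.
exact: (noetherian_surj (@nagataK K n 0) (hilbert_basis IH)).
Qed.

(** * The Nullstellensatz *)

Lemma ideal_comap (A B : comNzRingType) (phi : {rmorphism A -> B}) (I : B -> Prop) :
  is_ideal I -> is_ideal (fun a => I (phi a)).
Proof.
move=> hI; split; first by rewrite rmorph0; apply: idl0.
- by move=> x y hx hy; rewrite rmorphD; apply: idlD.
- by move=> a x hx; rewrite rmorphM; apply: idlMl.
Qed.

Section Nullstellensatz.
Variable K : closedFieldType.

(** A nonzero element of least degree generates the ideal; it is not constant, hence has a root. *)
Lemma proper_ideal_root (I : {poly K} -> Prop) : is_ideal I -> ~ I 1 ->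
  exists c, forall f, I f -> root f c.
Proof.
move=> hI n1; case: (classic (exists2 p, I p & p != 0)) => [[p0 hp0 np0]|h]; last first.
  exists 0 => f hf; case: (eqVneq f 0) => [->|nf]; first exact: root0.
  by case: h; exists f.
have [p [hp np min]] : exists p, [/\ I p, p != 0 &
    forall q, I q -> q != 0 -> (size p <= size q)%N].
  have [k] := ubnP (size p0); elim: k p0 hp0 np0 => // k IH p hp np; rewrite ltnS => sp.
  case: (classic (exists q, [/\ I q, q != 0 & (size q < size p)%N])).
    by case=> q [hq nq sq]; apply: (IH q) => //; apply: leq_trans sp.
  move=> h; exists p; split=> // q hq nq; rewrite leqNgt; apply/negP => sq.
  by apply: h; exists q.
have /closed_rootP[c hc] : size p != 1%N.
  apply/negP => /size_poly1P[c nc ec]; apply: n1.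
  have -> : 1 = (c^-1)%:P * p by rewrite ec -polyCM mulVf.
  exact: idlMl.
exists c => q hq.
have hr : I (q %% p).
  have -> : q %% p = q - (q %/ p) * p by rewrite {2}(divp_eq q p) addrAC subrr add0r.
  by apply: idlB => //; apply: idlMl.
suff e : q %% p = 0 by rewrite (divp_eq q p) e addr0 rootM hc orbT.
apply/eqP/negPn/negP => /(min _ hr); rewrite leqNgt.
by rewrite ltn_modp np.
Qed.

(** Induction on the number of variables. In Noether position the ideal contains a monic [g], and
    its contraction to the coefficients has a zero [a]. The ideal specialized at [a] is proper, so
    the one-variable case supplies the remaining coordinate. *)
Theorem nullstellensatz n (I : {mpoly K[n]} -> Prop) : is_ideal I -> ~ I 1 ->
  exists x : 'I_n -> K, forall f, I f -> f.@[x] = 0.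
Proof.
elim: n I => [|m IH] I hI n1.
  exists (fun _ => 0) => f hf.
  have ef : f = (f@_0)%:MP.
    apply/mpolyP => k; rewrite mcoeffC.
    have -> : k = 0%MM by apply/mnmP => [[]].
    by rewrite eqxx mulr1.
  rewrite ef mevalC; apply/eqP/negPn/negP => nf; apply: n1.
  have -> : 1 = ((f@_0)^-1)%:MP * f by rewrite {2}ef -mpolyCM mulVf.
  exact: idlMl.
case: (classic (exists2 p, I p & p != 0)) => [[p hp np]|h]; last first.
  exists (fun _ => 0) => f hf; case: (eqVneq f 0) => [->|nf]; first exact: meval0.
  by case: h; exists f.
have [e [c [nc gm]]] := noether_position np; set g := nagata e (c *: p) in gm.
pose I2 q := I (nagata_inv e q).
have hI2 : is_ideal I2 by apply: ideal_comap.
have I2g : I2 g by rewrite /I2 nagataK -mul_mpolyC; apply: idlMl.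
have nI2 : ~ I2 1 by rewrite /I2 rmorph1.
have sg : (1 < size g)%N.
  rewrite ltnNge; apply/negP => /size1_polyC eg; apply: nI2.
  by move: I2g; move/eqP: gm; rewrite eg lead_coefC => ->; rewrite polyC1.
have [|a ha] := IH (fun a => I2 a%:P) (ideal_comap _ hI2); first by rewrite polyC1.
pose ev := map_poly (meval a); pose I3 r := exists2 q, I2 q & ev q = r.
have hI3 : is_ideal I3.
  split; first by exists 0; [exact: idl0|rewrite /ev rmorph0].
  - move=> _ _ [q hq <-] [r hr <-]; exists (q + r); first exact: idlD.
    by rewrite /ev rmorphD.
  - move=> r _ [q hq <-]; exists (map_poly (@mpolyC m K) r * q); first exact: idlMl.
    rewrite /ev rmorphM /= -map_poly_comp; congr (_ * _).
    by rewrite map_poly_id // => x _ /=; rewrite mevalC.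
have nI3 : ~ I3 1.
  (* If [f] specializes to 1, a resultant with [g] lies in the contraction and vanishes at [a],
     although 1 and [ev g] are coprime. Adding a high multiple of [g] makes [f] monic, so that the
     resultant commutes with specialization, and keeps it congruent to 1 modulo [ev g]. *)
  case=> f hf ef; pose f' := f + 'X^(size f) * g.
  have sX : size ('X^(size f) * g) = (size f + size g)%N.
    by rewrite size_monicM ?monicXn ?monic_neq0 // size_polyXn.
  have lt : (size f < size ('X^(size f) * g)%R)%N.
    by rewrite sX -[X in (X < _)%N]addn0 ltn_add2l (ltn_trans _ sg).
  have f'm : f' \is monic.
    by rewrite monicE /f' addrC lead_coefDl // -monicE monicMl ?monicXn.
  have sf' : (1 < size f')%N.
    by rewrite /f' addrC size_polyDl // sX (leq_trans sg) // leq_addl.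
  (* [map_resultant] only covers polynomial coefficient rings: lift to [{poly A}] *)
  pose up := map_poly (@polyC {mpoly K[m]}).
  have szu q : size (up q) = size q by rewrite size_map_inj_poly ?polyC0 //; apply: polyC_inj.
  have upK q : map_poly (horner_eval 0) (up q) = q.
    by rewrite -map_poly_comp map_poly_id // => x _; rewrite /= horner_evalE hornerC.
  have [||[u v] /= [_ _ eres]] := @resultant_in_ideal _ (up f') (up g); rewrite ?szu //.
  set r := resultant _ _ in eres.
  have r0 : meval a r.[0] = 0.
    apply: ha; have -> : r.[0]%:P = map_poly (horner_eval 0) u * f' + map_poly (horner_eval 0) v * g.
      by rewrite -[f' in RHS]upK -[g in RHS]upK -!rmorphM -rmorphD /= -eres map_polyC.
    apply: (idlD hI2); apply: (idlMl _ hI2); last exact: I2g.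
    by apply: (idlD hI2 hf); apply: (idlMl _ hI2).
  pose phi : {rmorphism {poly {mpoly K[m]}} -> K} := meval a \o horner_eval 0.
  have evE q : map_poly phi (up q) = ev q.
    by rewrite /ev -[in RHS](upK q) -[RHS]map_poly_comp.
  have lc q : q \is monic -> phi (lead_coef (up q)) != 0.
    move=> /eqP qm; rewrite lead_coef_map_inj ?polyC0 //; last exact: polyC_inj.
    by rewrite qm rmorph1 oner_eq0.
  have : phi r = 0 by rewrite /phi /= horner_evalE.
  rewrite /r map_resultant ?lc // !evE.
  move/eqP; rewrite resultant_eq0.
  have -> : ev f' = 1 + ev 'X^(size f) * ev g by rewrite -ef /ev -rmorphM -rmorphD.
  set d := gcdp _ _.
  have dg : d %| ev g by apply: dvdp_gcdr.
  have : d %| 1.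
    have := dvdp_gcdl (1 + ev 'X^(size f) * ev g) (ev g).
    by rewrite -/d dvdp_addl // dvdp_mull.
  by rewrite dvdp1 => /eqP ->.
have [z hz] := proper_ideal_root hI3 nI3.
exists (fun i => (ev (nagata e 'X_i)).[z]) => f hf.
have -> : f.@[fun i => (ev (nagata e 'X_i)).[z]] = (ev (nagata e f)).[z].
  apply: (mpoly_rmorphism_ext (f := meval _)
    (g := horner_eval z \o (map_poly (meval a) \o nagata e))) => [b|i] /=.
    by rewrite mevalC nagataC map_polyC /= mevalC horner_evalE hornerC.
  by rewrite mevalXU.
apply/rootP/hz; exists (nagata e f); last exact: erefl.
rewrite /I2 nagataK; exact: hf.
Qed.

Lemma eval_kernel_ideal n (x : 'I_n -> K) : is_ideal (fun f => f.@[x] = 0).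
Proof.
split; first exact: meval0; first by move=> f g /= ef eg; rewrite mevalD ef eg addr0.
by move=> a f /= ef; rewrite mevalM ef mulr0.
Qed.

Lemma maximal_ideal_point n (M : {mpoly K[n]} -> Prop) : is_maximal M ->
  exists x : 'I_n -> K, forall f, M f <-> f.@[x] = 0.
Proof.
case=> hM n1 max; have [x hx] := nullstellensatz hM n1; exists x => f; split.
  exact: hx.
apply: (max _ (eval_kernel_ideal x)) => //.
by move/eqP; rewrite rmorph1 oner_eq0.
Qed.

End Nullstellensatz.

(** * Homogeneous ideals and the projective Nullstellensatz *)

Section Homogeneous.
Variables (K : fieldType) (n : nat).
Local Notation S := {mpoly K[n]}.

Lemma pihomogM_homog (p q : S) d k : q \is d.-homog ->
  pihomog mdeg k (p * q) = if (d <= k)%N then pihomog mdeg (k - d) p * q else 0.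
Proof.
move=> hq; rewrite [p in LHS](pihomog_partitionE (leqnn (msize p))) mulr_suml raddf_sum /=.
have hom j : pihomog mdeg j p * q \is (j + d).-homog by apply: dhomogM (pihomogP _ _ _) hq.
case: leqP => h; last first.
  rewrite big1 // => i _; rewrite (pihomog_ne0 _ (hom i)) //.
  by rewrite neq_ltn (leq_trans h) ?orbT // leq_addl.
case: (ltnP (k - d) (msize p)) => hk; last first.
  have -> : pihomog mdeg (k - d) p = 0.
    rewrite pihomogE big_seq_cond big_pred0 // => m.
    apply/negP => /andP[/msize_mdeg_lt hm /eqP e].
    by move: hk; rewrite leqNgt -e hm.
  rewrite mul0r big1 // => i _; rewrite (pihomog_ne0 _ (hom i)) //.
  apply/eqP => e; have := leq_trans (ltn_ord i) hk.
  by rewrite -e addnK ltnn.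
rewrite (bigD1 (Ordinal hk)) //= big1 ?addr0.
  by rewrite pihomog_dE // -{2}(subnK h).
move=> i ni; rewrite (pihomog_ne0 _ (hom i)) //.
by apply: contra ni => /eqP e; apply/eqP/val_inj; rewrite /= -e addnK.
Qed.

Lemma genI_homogeneous (fs : seq S) (ds : nat -> nat) :
  (forall i, (i < size fs)%N -> fs`_i \is (ds i).-homog) -> homogeneous_ideal (genI fs).
Proof.
move=> h; split; first exact: genI_ideal.
move=> _ [c ->] k; rewrite raddf_sum /=; apply: idl_sum => [|i _].
  exact: genI_ideal.
rewrite (pihomogM_homog _ _ (h i (ltn_ord i))); case: ifP => _.
  by apply: idlMl; [exact: genI_ideal | apply: genI_mem; apply: mem_nth].
by apply: idl0; apply: genI_ideal.
Qed.

Lemma colonI_homogeneous I (f : S) d : f \is d.-homog -> homogeneous_ideal I ->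
  homogeneous_ideal (colonI I f).
Proof.
move=> hf [hI hh]; split; first exact: colonI_ideal.
move=> g hg k; have := hh _ hg (k + d)%N.
by rewrite (pihomogM_homog _ _ hf) leq_addl addnK.
Qed.

End Homogeneous.

(* A relation [1 = c + h * (X_i - 1)] with [c] in [C] says, degree by degree,
   that the degree-[k] part of [h] is [- X_i ^ k] modulo [C].              *)
Lemma homogeneous_nullstellensatz (K : closedFieldType) n (C : {mpoly K[n]} -> Prop) :
  homogeneous_ideal C ->
  (forall x : 'I_n -> K, (forall f, C f -> f.@[x] = 0) -> forall i, x i = 0) ->
  forall i, exists k, C ('X_i ^+ k).
Proof.
move=> [hC homC] hz i.
pose C' := addI C (genI [:: 'X_i - 1]).
have hC' : is_ideal C' by apply: addI_ideal (genI_ideal _).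
have [[c [y [hc /genI1P[h ->] e1]]]|n1] := classic (C' 1); last first.
  have [x hx] := nullstellensatz hC' n1.
  have /eqP : ('X_i - 1 : {mpoly K[n]}).@[x] = 0.
    by apply: hx; apply: (addI_right hC); apply: genI_mem; rewrite inE.
  rewrite rmorphB rmorph1 /= mevalXU hz ?sub0r ?oppr_eq0 ?oner_eq0 //.
  by move=> f hf; apply: hx; apply: (addI_left (genI_ideal _)) hf.
have hXi : ('X_i : {mpoly K[n]}) \is 1.-homog by rewrite dhomogX /= mdeg1.
have h1 : (1 : {mpoly K[n]}) \is 0.-homog by apply: dhomog1.
have part k : C (pihomog mdeg k h + 'X_i ^+ k).
  elim: k => [|k IHk].
    have := congr1 (pihomog mdeg 0) e1; rewrite mulrBr mulr1 raddfD raddfB /=.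
    rewrite (pihomogM_homog _ _ hXi) /= pihomog_dE // expr0 sub0r => e.
    by rewrite addrC e subrK; apply: homC.
  have := congr1 (pihomog mdeg k.+1) e1; rewrite mulrBr mulr1 raddfD raddfB /=.
  rewrite (pihomogM_homog _ _ hXi) /= subn1 /= (pihomog_ne0 _ h1) // => e.
  have -> : pihomog mdeg k.+1 h + 'X_i ^+ k.+1 =
      pihomog mdeg k.+1 c + 'X_i * (pihomog mdeg k h + 'X_i ^+ k).
    apply/eqP; rewrite -subr_eq0; apply/eqP; rewrite -[RHS]oppr0 [in RHS]e exprS; ring.
  by apply: idlD; [exact: hC|exact: homC|apply: idlMl].
exists (msize h); have := part (msize h).
suff -> : pihomog mdeg (msize h) h = 0 by rewrite add0r.
rewrite pihomogE big_seq_cond big_pred0 // => m.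
by apply/negP => /andP[/msize_mdeg_lt hm /eqP e]; move: hm; rewrite e ltnn.
Qed.

(** * Growth of quotients *)

Section Growth.
Variables (K : fieldType) (n : nat).
Local Notation S := {mpoly K[n]}.
Implicit Types (I : S -> Prop) (p : S).

Lemma msizeM_leS p (q : S) a b : (msize p <= a.+1)%N -> (msize q <= b.+1)%N ->
  (msize (p * q) <= (a + b).+1)%N.
Proof.
case: (eqVneq p 0) => [->|np]; first by rewrite mul0r msize0.
case: (eqVneq q 0) => [->|nq]; first by rewrite mulr0 msize0.
by rewrite msizeM //; move: (msize p) (msize q) => x y; lia.
Qed.

Lemma msizeX_leS p a k : (msize p <= a.+1)%N -> (msize (p ^+ k) <= (k * a).+1)%N.
Proof.
move=> hp; elim: k => [|k IH]; first by rewrite expr0 msize1.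
by rewrite exprS mulSn; apply: msizeM_leS.
Qed.

(* [S/I] grows at least like a polynomial of degree [q] in the degree. *)
Definition growth I (q : nat) : Prop :=
  exists e, forall t, exists (T : finType) (v : T -> S),
    [/\ #|T| = (t ^ q)%N, forall i, (msize (v i) <= (e * t).+1)%N &
        forall c : T -> K, I (\sum_i c i *: v i) -> forall i, c i = 0].

Lemma growth_sub I I' q : subI I I' -> growth I' q -> growth I q.
Proof.
move=> h [e he]; exists e => t; have [T [v [h1 h2 h3]]] := he t.
by exists T, v; split=> // c hc; apply: h3; apply: h.
Qed.

Lemma growth0 I : is_ideal I -> ~ I 1 -> growth I 0.
Proof.
move=> hI n1; exists 0%N => t; exists unit, (fun _ => 1); split.
- by rewrite card_unit.
- by move=> _; rewrite msize1.
move=> c; rewrite (big_pred1 tt) => [hc []|[]//]; apply/eqP/negPn/negP => nc; apply: n1.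
have -> : 1 = (c tt)^-1%:MP * (c tt *: 1) :> S.
  by rewrite mul_mpolyC scalerA mulVf // scale1r.
exact: idlMl.
Qed.

(** If the [v i] are independent modulo [I'], then the [z ^ j * v i] with [j < t] are independent
    modulo [I]: modulo [I'] only the part with [j = 0] of a relation survives, so it vanishes, and
    [z] cancels from the rest. *)
Lemma growth_step I I' z q : is_ideal I -> is_ideal I' -> subI I I' -> I' z ->
  nzd_mod I z -> growth I' q -> growth I q.+1.
Proof.
move=> hI hI' sub hz reg [e he]; exists (e + msize z)%N => t.
have [T [v [h1 h2 h3]]] := he t.
exists ('I_t * T)%type, (fun ji : 'I_t * T => z ^+ ji.1 * v ji.2); split.
- by rewrite card_prod card_ord h1 expnS.
- case=> j i /=; have hz' : (msize z <= (msize z).+1)%N by [].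
  apply: leq_trans (msizeM_leS (msizeX_leS j hz') (h2 i)) _.
  rewrite ltnS mulnDl addnC leq_add2l mulnC leq_mul2l.
  by rewrite (ltnW (ltn_ord j)) orbT.
have key k (c : nat -> T -> K) : I (\sum_(j < k) z ^+ j * \sum_i c j i *: v i) ->
    forall j i, (j < k)%N -> c j i = 0.
  elim: k c => [//|k IH] c; rewrite big_ord_recl expr0 mul1r.
  have -> : \sum_(j < k) z ^+ lift ord0 j * (\sum_i c (lift ord0 j) i *: v i) =
      z * \sum_(j < k) z ^+ j * (\sum_i c j.+1 i *: v i).
    by rewrite mulr_sumr; apply: eq_bigr => j _; rewrite exprS mulrA.
  move=> hc; have c0 : forall i, c 0%N i = 0.
    by apply: h3; have := sub _ hc; rewrite addrC => /(idlDl _ hI' (idlMr _ hI' hz)).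
  move: hc; rewrite big1 => [|i _]; last by rewrite /= c0 scale0r.
  by rewrite add0r => /reg /(IH (fun j => c j.+1)) h [|j] i //; rewrite ltnS => /h.
move=> c; have -> : \sum_i c i *: (z ^+ i.1 * v i.2) =
    \sum_(j < t) \sum_i c (j, i) *: (z ^+ j * v i).
  by rewrite pair_bigA; apply: eq_bigr => -[].
move=> hc [j i].
pose c' k i := if insub k is Some j then c (j, i) else 0.
have c'E (k : 'I_t) l : c' k l = c (k, l) by rewrite /c' valK.
rewrite -c'E; apply: (key t) (ltn_ord j).
move: hc; congr I; apply: eq_bigr => k _; rewrite mulr_sumr; apply: eq_bigr => l _.
by rewrite c'E scalerAr.
Qed.

(** In degree at most [e * t] every exponent is below [(e * t).+1], so at most [(e * t).+1 ^ n]
    elements are independent, which is eventually less than [t ^ n.+1]. *)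
Lemma growth_le q : growth (@zeroI S) q -> (q <= n)%N.
Proof.
case=> e he.
have bound t : (t ^ q <= (e * t).+1 ^ n)%N.
  have [T [v [h1 h2 h3]]] := he t.
  pose F := {ffun 'I_n -> 'I_(e * t).+1}.
  have cF : #|F| = ((e * t).+1 ^ n)%N by rewrite card_ffun !card_ord.
  rewrite -h1 -cF.
  pose A : 'M[K]_(#|T|, #|F|) :=
    \matrix_(i, j) (v (enum_val i))@_[multinom ((enum_val j : F) k : nat) | k < n].
  suff fA : row_free A by have := rank_leq_col A; rewrite (eqP fA).
  rewrite -kermx_eq0; apply/eqP/row_matrixP => l; rewrite row0.
  set u := row l _; have uA : u *m A = 0 by rewrite -row_mul mulmx_ker row0.
  have e0 : \sum_i u 0 (enum_rank i) *: v i = 0.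
    apply/mpolyP => m; rewrite raddf_sum mcoeff0 /=.
    case: (ltnP (mdeg m) (e * t).+1) => hm; last first.
      rewrite big1 // => i _; rewrite mcoeffZ.
      by rewrite memN_msupp_eq0 ?mulr0 // msize_mdeg_ge // (leq_trans (h2 i)).
    have hk k : (m k < (e * t).+1)%N.
      by apply: leq_ltn_trans hm; rewrite mdegE (bigD1 k) //= leq_addr.
    have := congr1 (fun M : 'rV_ _ => M 0 (enum_rank [ffun k => Ordinal (hk k)])) uA.
    rewrite !mxE => E; rewrite -[RHS]E (reindex _ (onW_bij _ (enum_val_bij T))) /=.
    apply: eq_bigr => i _; rewrite enum_valK mcoeffZ !mxE; congr (_ * _).
    by congr mcoeff; apply/mnmP => k; rewrite mnmE enum_rankK ffunE.
  apply/rowP => i; rewrite [RHS]mxE -[i]enum_valK.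
  exact: (h3 (fun j => u 0 (enum_rank j)) e0).
rewrite leqNgt; apply/negP => hq.
(* Growth above [n] would give [t ^ n.+1 <= (e.+1 * t) ^ n], that is [t <= e.+1 ^ n]. *)
pose t := (e.+1 ^ n).+1.
have h1 : (e * t < e.+1 * t)%N by rewrite ltn_pmul2r.
have h2 : ((e * t).+1 ^ n <= (e.+1 * t) ^ n)%N.
  by case: (posnP n) => [->|n0] //; rewrite leq_exp2r.
have := leq_trans (bound t) h2.
rewrite expnMn; have : (t ^ n.+1 <= t ^ q)%N by rewrite leq_pexp2l.
move=> h3 h4; have := leq_trans h3 h4; rewrite expnS leq_pmul2r ?expn_gt0 //.
by rewrite ltnn.
Qed.

Lemma growth_subring k (iota : {rmorphism {mpoly K[k]} -> S}) I :
  (forall c, iota c%:MP = c%:MP) -> (forall b, I (iota b) -> b = 0) -> growth I k.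
Proof.
move=> iC inj; exists (\sum_i msize (iota 'X_i))%N => t.
exists {ffun 'I_k -> 'I_t}, (fun f : {ffun 'I_k -> 'I_t} => iota 'X_[[multinom (f j : nat) | j < k]]); split.
- by rewrite card_ffun !card_ord.
- move=> f; rewrite mpolyXE_id rmorph_prod big_distrl /=.
  elim/big_rec2: _ => [|i s y _ IH]; first by rewrite msize1.
  apply: msizeM_leS IH; rewrite rmorphXn mnmE.
  have h : (msize (iota 'X_i) <= (msize (iota 'X_i)).+1)%N by [].
  apply: leq_trans (msizeX_leS _ h) _.
  by rewrite ltnS mulnC leq_mul2l (ltnW (ltn_ord _)) orbT.
move=> c hc f; have /inj e : I (iota (\sum_(f : {ffun 'I_k -> 'I_t}) c f *: 'X_[[multinom (f j : nat) | j < k]])).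
  move: hc; congr I; rewrite rmorph_sum; apply: eq_bigr => g _.
  by rewrite -!mul_mpolyC rmorphM iC.
have := congr1 (mcoeff [multinom (f j : nat) | j < k]) e.
rewrite raddf_sum mcoeff0 (bigD1 f) //= mcoeffZ mcoeffX eqxx mulr1 big1 ?addr0 // => g ng.
rewrite mcoeffZ mcoeffX; case: eqP => [h|_]; last by rewrite mulr0.
case/eqP: ng; apply/ffunP => i; apply/val_inj.
by have := congr1 (fun m : 'X_{1..k} => m i) h; rewrite !mnmE.
Qed.

(** An element of the larger of two consecutive primes, outside the smaller one, is regular modulo
    the smaller: each inclusion is one [growth_step]. *)
Lemma growth_chain I P h q : prime_chain I P h -> growth P q -> growth I (q + h).
Proof.
case=> p [hp hs he] gP.
have : growth (p h) q by apply: growth_sub gP => x /he.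
have key i : (i <= h)%N -> growth (p h) q -> growth (p (h - i)%N) (q + i).
  elim: i => [|i IH] hi g; first by rewrite subn0 addn0.
  have g' := IH (ltnW hi) g.
  have e : (h - i)%N = (h - i.+1).+1 by rewrite subnSK.
  have [h1 h2] := hs (h - i.+1)%N ltac:(lia).
  have [p1 _] := hp (h - i.+1)%N (leq_subr _ _).
  have [p2 _] := hp (h - i)%N (leq_subr _ _).
  have [z [hz nz]] : exists z, p (h - i)%N z /\ ~ p (h - i.+1)%N z.
    apply: NNPP => nex; apply: h2 => x; rewrite -e => hx; apply: NNPP => nx.
    by apply: nex; exists x.
  rewrite addnS; apply: (growth_step (z := z)) g' => //; try exact: prime_ideal.
    by rewrite e.
  by move=> y; case: p1 => _ _ hM /hM[].
move=> /(key h (leqnn h)); rewrite subnn; apply: growth_sub.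
by have [_] := hp 0%N isT.
Qed.

Lemma growth_regular2 f g q : regular_sequence [:: f; g] ->
  growth (genI [:: f; g]) q -> (q.+2 <= n)%N.
Proof.
move/regular_sequence2P => [regf regg n1] gr; apply: growth_le.
apply: (growth_step (I' := genI [:: f]) (z := f)) => //.
- exact: zeroI_ideal.
- exact: genI_ideal.
- by move=> x ->; apply: idl0; apply: genI_ideal.
- by apply: genI_mem; rewrite inE.
apply: (growth_step (I' := genI [:: f; g]) (z := g)) gr => //.
- exact: genI_ideal.
- exact: genI_ideal.
- by apply: genI_sub => x; rewrite !inE => ->.
- by apply: genI_mem; rewrite !inE eqxx orbT.
Qed.

End Growth.

(** * Complete intersections of codimension two *)

Section PolyIdeal.
Variable A : comNzRingType.
Implicit Types (b : A -> Prop) (p q f r : {poly A}).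

Definition polyI b : {poly A} -> Prop := fun p => forall i, b p`_i.

Lemma polyI_ideal b : is_ideal b -> is_ideal (polyI b).
Proof.
move=> hb; split.
- by move=> i; rewrite coef0; apply: idl0.
- by move=> p q hp hq i; rewrite coefD; apply: idlD.
- by move=> p q hq i; rewrite coefM; apply: idl_sum => // j _; apply: idlMl.
Qed.

Lemma polyI_C b a : is_ideal b -> b a -> polyI b a%:P.
Proof. by move=> hb ha i; rewrite coefC; case: eqP => // _; apply: idl0. Qed.

Lemma polyI_min b (L : {poly A} -> Prop) : is_ideal L ->
  (forall a, b a -> L a%:P) -> subI (polyI b) L.
Proof.
move=> hL h p hp; rewrite -[p]coefK poly_def; apply: idl_sum => // i _.
by rewrite -mul_polyC; apply: idlMr => //; apply: h.
Qed.

Lemma polyI_monic b f q r : is_ideal b -> f \is monic -> (size r < size f)%N ->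
  polyI b (f * q - r) -> polyI b q.
Proof.
move=> hb hf sr; have [n] := ubnP (size q); elim: n q => // n IH q; rewrite ltnS => sq h.
case: (eqVneq q 0) => [->|nq]; first by move=> i; rewrite coef0; apply: idl0.
have sq0 : (0 < size q)%N by rewrite size_poly_gt0.
have sf0 : (0 < size f)%N by apply: leq_ltn_trans sr.
have hl : b (lead_coef q).
  have := h (size (f * q)).-1; rewrite coefB -/(lead_coef (f * q)) lead_coef_monicM //.
  rewrite size_monicM // [r`_ _]nth_default ?subr0 //.
  rewrite -ltnS; apply: leq_trans sr _; rewrite -subn1.
  by move: (size f) (size q) sf0 sq0 => x y; lia.
set t := lead_coef q *: 'X^((size q).-1).
have ht : polyI b t.
  by move=> i; rewrite coefZ; apply: idlMr.
rewrite -[q](subrK t); refine (idlD (polyI_ideal hb) _ ht).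
apply: IH.
  apply: leq_trans sq; rewrite -[X in (_ < X)%N](prednK sq0) ltnS.
  apply: size_le_leadcoef0; last first.
    by rewrite coefB coefZ coefXn eqxx mulr1 subrr.
  rewrite prednK //; apply: leq_trans (size_polyD _ _) _; rewrite size_polyN geq_max leqnn /=.
  by apply: leq_trans (size_scale_leq _ _) _; rewrite size_polyXn prednK.
have -> : f * (q - t) - r = (f * q - r) - f * t by ring.
have hP := polyI_ideal hb.
exact: idlB hP h (idlMl _ hP ht).
Qed.

Lemma nzd_mod_monic b f : is_ideal b -> f \is monic -> nzd_mod (polyI b) f.
Proof.
move=> hb hf p hp; apply: (@polyI_monic b f p 0) => //; last by rewrite subr0.
by rewrite size_poly0 size_poly_gt0 monic_neq0.
Qed.

(** Modulo a monic [f] the polynomials are free over [A], with the coefficients of the remainder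
    [p0] as coordinates, and [a] acts on each coordinate separately. *)
Lemma nzd_mod_polyC b f a : is_ideal b -> f \is monic -> nzd_mod b a ->
  nzd_mod (addI (polyI b) (genI [:: f])) a%:P.
Proof.
move=> hb hf ha p [h [_ [hh /genI1P[c ->] e]]].
have hP := polyI_ideal hb.
have ep := Pdiv.RingMonic.rdivp_eq hf p.
set p0 := Pdiv.Ring.rmodp p f in ep; set q := Pdiv.Ring.rdivp p f in ep.
have sp0 : (size p0 < size f)%N by apply: Pdiv.Ring.ltn_rmodpN0; apply: monic_neq0.
have e2 : f * (c - a%:P * q) - a%:P * p0 = - h.
  apply/eqP; rewrite -subr_eq0; apply/eqP.
  have -> : f * (c - a%:P * q) - a%:P * p0 - - h = (h + c * f) - a%:P * (q * f + p0) by ring.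
  by rewrite -ep e subrr.
have hq : polyI b (c - a%:P * q).
  apply: (@polyI_monic b f _ (a%:P * p0)) => //; last by rewrite e2; exact (idlN hP hh).
  by apply: leq_ltn_trans sp0; rewrite mul_polyC size_scale_leq.
have hp0 : polyI b p0.
  move=> i; apply: ha; rewrite -coefCM.
  have -> : a%:P * p0 = h + f * (c - a%:P * q) by rewrite -[h]opprK -e2; ring.
  refine (idlD hP hh _ _); exact (idlMl _ hP hq).
exists p0, (q * f); split=> //; first by apply/genI1P; exists q.
by rewrite {1}ep addrC.
Qed.

Lemma polyI_addI b (r : A) : is_ideal b ->
  subI (polyI (addI b (genI [:: r]))) (addI (polyI b) (genI [:: r%:P])).
Proof.
move=> hb; have hP := polyI_ideal hb; apply: polyI_min.
  exact: addI_ideal hP (genI_ideal _).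
move=> _ [s [_ [hs /genI1P[t ->] ->]]].
exists s%:P, (t%:P * r%:P); split; first exact: polyI_C.
  by apply/genI1P; exists t%:P.
by rewrite polyCD polyCM.
Qed.

End PolyIdeal.

(* Linkage: [r] lies in [(f, g)], so [r = alpha f + beta g], and [b] is regular
   modulo [(f, r)]; multiplying by [beta], which is regular modulo [f] because
   [r] is, carries a relation modulo [(f, g)] to one modulo [(f, r)].       *)
Lemma nzd_mod_linkage (B : comNzRingType) (b : B -> Prop) (x : B) (r : {poly B})
    (f g alpha beta : {poly {poly B}}) :
  is_ideal b -> r \is monic -> f \is monic -> r%:P = alpha * f + beta * g ->
  nzd_mod b x ->
  nzd_mod (addI (genI [:: f; g]) (polyI (polyI b))) x%:P%:P.
Proof.
move=> hb hr hf er hx.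
have hb1 := polyI_ideal hb; have hb2 := polyI_ideal hb1.
have ha1 : is_ideal (addI (polyI b) (genI [:: r])) by apply: addI_ideal (genI_ideal _).
have hL2 : is_ideal (addI (polyI (polyI b)) (genI [:: f])).
  by apply: addI_ideal (genI_ideal _).
have nzx := nzd_mod_polyC ha1 hf (nzd_mod_polyC hb hr hx).
have nzr := nzd_mod_polyC hb1 hf (nzd_mod_monic hb hr).
have nzbeta : nzd_mod (addI (polyI (polyI b)) (genI [:: f])) beta.
  move=> y hy; apply: nzr; rewrite er.
  have -> : (alpha * f + beta * g) * y = (alpha * y) * f + g * (beta * y) by ring.
  apply: idlD => //; last exact: idlMl.
  by apply: addI_right => //; apply/genI1P; exists (alpha * y).
move=> y [_ [h [/genI2P[u [v ->]] hh e]]].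
have hL1 : is_ideal (addI (polyI (addI (polyI b) (genI [:: r]))) (genI [:: f])).
  by apply: addI_ideal (genI_ideal _); apply: polyI_ideal.
have := nzx (beta * y).
have -> : x%:P%:P * (beta * y) = v * r%:P + beta * h + (beta * u - v * alpha) * f.
  by rewrite er mulrCA e; ring.
case.
  exists (v * r%:P + beta * h), ((beta * u - v * alpha) * f); split=> //.
    have ha2 := polyI_ideal ha1.
    refine (idlD ha2 (idlMl _ ha2 _) (idlMl _ ha2 _)).
      by apply: polyI_C => //; apply: addI_right => //; apply: genI_mem; rewrite inE.
    by move=> i; apply: addI_left => //; exact: genI_ideal.
  by apply/genI1P; exists (beta * u - v * alpha).
move=> h1 [_ [/(polyI_addI hb1)[h2 [_ [hh2 /genI1P[w ->] ->]]] /genI1P[c ->] e2]].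
have [|h3 [_ [hh3 /genI1P[c' ->] e3]]] := nzbeta (y - w * g).
  exists h2, ((c + w * alpha) * f); split=> //; first by apply/genI1P; exists (c + w * alpha).
  by rewrite mulrBr e2 er; ring.
exists (c' * f + w * g), h3; split=> //; first by apply/genI2P; exists c', w.
by rewrite -[y](subrK (w * g)) e3; ring.
Qed.

Definition imageI (A B : comNzRingType) (phi : A -> B) (b : A -> Prop) : B -> Prop :=
  spanI (fun y => exists2 x, b x & y = phi x).

(** Linkage carried back along an isomorphism. The factor [w] rescales [f] to make its image monic
    and [u] undoes it, so [(f, g)] is unchanged. *)
Lemma nzd_mod_transport (S B : comNzRingType) (phi : {rmorphism S -> {poly {poly B}}})
    (psi : {rmorphism {poly {poly B}} -> S}) (f g u w : S) (r : {poly B}) :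
  cancel phi psi -> cancel psi phi ->
  f = u * (w * f) -> phi (w * f) \is monic -> r \is monic -> genI [:: f; g] (psi r%:P) ->
  forall b x, is_ideal b -> nzd_mod b x ->
  nzd_mod (addI (genI [:: f; g]) (imageI (fun x : B => psi x%:P%:P) b)) (psi x%:P%:P).
Proof.
move=> phiK psiK ef fm rm hr b x hb hx y.
have hI := genI_ideal [:: f; g]; set I := genI _ in hr hI *.
pose f' := phi (w * f); pose g' := phi g.
have gen_phi : subI I (fun s => genI [:: f'; g'] (phi s)).
  apply: genI_min; first exact/ideal_comap/genI_ideal.
  move=> s; rewrite !inE => /orP[/eqP->|/eqP->]; apply/genI2P.
    by exists (phi u), 0; rewrite mul0r addr0 /f' -rmorphM -ef.
  by exists 0, 1; rewrite mul0r add0r mul1r.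
have gen_psi : subI (genI [:: f'; g']) (fun s => I (psi s)).
  apply: genI_min; first exact: ideal_comap.
  move=> s; rewrite !inE => /orP[/eqP->|/eqP->]; rewrite phiK.
    by apply: idlMl => //; apply: genI_mem; rewrite inE eqxx.
  by apply: genI_mem; rewrite !inE eqxx orbT.
have [alpha [beta er]] : exists alpha beta, r%:P = alpha * f' + beta * g'.
  by apply/genI2P; rewrite -[r%:P]psiK; apply: gen_phi.
have hb2 := polyI_ideal (polyI_ideal hb).
have hT : is_ideal (addI (genI [:: f'; g']) (polyI (polyI b))).
  exact: addI_ideal (genI_ideal _) hb2.
have to : subI (addI I (imageI (fun x => psi x%:P%:P) b))
    (fun s => addI (genI [:: f'; g']) (polyI (polyI b)) (phi s)).
  apply: addI_min; first exact: ideal_comap.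
    by move=> s /gen_phi; apply: addI_left.
  apply: spanI_min; first exact: ideal_comap.
  move=> _ [z hz ->]; rewrite psiK; apply: addI_right; first exact: genI_ideal.
  exact (polyI_C (polyI_ideal hb) (polyI_C hb hz)).
have from : subI (addI (genI [:: f'; g']) (polyI (polyI b)))
    (fun s => addI I (imageI (fun x => psi x%:P%:P) b) (psi s)).
  have hJ : is_ideal (addI I (imageI (fun x => psi x%:P%:P) b)).
    exact: addI_ideal (spanI_ideal _).
  have hJ' := ideal_comap psi hJ.
  apply: addI_min => //.
    by move=> s /gen_psi; apply: addI_left; apply: spanI_ideal.
  apply: polyI_min => // p hp.
  apply: (polyI_min (ideal_comap polyC hJ')) hp => z hz.
  by apply: addI_right => //; apply: spanI_mem; exists z.
move=> /to; rewrite rmorphM psiK => /(nzd_mod_linkage hb rm fm er hx) /from.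
by rewrite phiK.
Qed.

Section CompleteIntersection.
Variables (K : fieldType) (m : nat) (f g : {mpoly K[m.+2]}).
Hypothesis reg : regular_sequence [:: f; g].
Local Notation S := {mpoly K[m.+2]}.
Local Notation A := {mpoly K[m.+1]}.
Local Notation B := {mpoly K[m]}.
Let I := genI [:: f; g].

Let hI : is_ideal I. Proof. exact: genI_ideal. Qed.

(** Otherwise the polynomial ring in [m.+1] variables embeds in [S / I], whose growth is at most
    [m]. *)
Lemma elimination_nonzero e : exists2 a : A, a != 0 & I (nagata_inv e a%:P).
Proof.
apply: NNPP => h.
have : growth I m.+1.
  apply: (growth_subring (iota := nagata_inv e \o polyC)) => [c|b hb] /=.
    by rewrite nagata_invC /nagata_inv_coef mmapC.
  by apply/eqP/negPn/negP => nb; apply: h; exists b.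
by move=> /(growth_regular2 reg); rewrite ltnn.
Qed.

(* This is flatness of [S / I] over [B], which is all of Cohen-Macaulayness
   that is used below; [imageI iota b] is the extension of [b] to [S]. *)
Lemma flat_projection : exists iota : {rmorphism B -> S},
  (forall c, iota c%:MP = c%:MP) /\
  forall b x, is_ideal b -> nzd_mod b x -> nzd_mod (addI I (imageI iota b)) (iota x).
Proof.
have nf : f != 0.
  case/regular_sequence2P: reg => h _ _; apply/eqP => f0.
  by have /eqP := h 1 ltac:(by rewrite f0 mul0r); rewrite oner_eq0.
have [e1 [c1 [nc1 m1]]] := noether_position nf.
have [a na ha] := elimination_nonzero e1.
have [e2 [c2 [nc2 m2]]] := noether_position na.
pose phi : {rmorphism S -> {poly {poly B}}} := map_poly (nagata e2) \o nagata e1.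
pose psi : {rmorphism {poly {poly B}} -> S} := nagata_inv e1 \o map_poly (nagata_inv e2).
have phiK : cancel phi psi.
  move=> p; rewrite /= -map_poly_comp map_poly_id ?nagataK // => z _ /=.
  exact: nagataK.
have psiK : cancel psi phi.
  move=> p; rewrite /= nagata_invK -map_poly_comp map_poly_id // => z _ /=.
  exact: nagata_invK.
pose iota : {rmorphism B -> S} := psi \o (polyC \o polyC).
exists iota; split=> [c|b x hb hx].
  by rewrite /= map_polyC /= !nagata_invC /nagata_inv_coef !mmapC.
have ef : f = (c1^-1)%:MP * (c1%:MP * f) by rewrite mulrA -mpolyCM mulVf // mul1r.
have fm : phi (c1%:MP * f) \is monic.
  by rewrite mul_mpolyC; apply: monic_map.
apply: (nzd_mod_transport phiK psiK ef fm m2) => //.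
have -> : psi (nagata e2 (c2 *: a))%:P = nagata_inv e1 (c2 *: a)%:P.
  by rewrite /= map_polyC /= nagataK.
by rewrite -mul_mpolyC polyCM rmorphM; apply: (idlMl _ hI ha).
Qed.

(** If [Q] contains [iota b] with [b != 0], flatness makes it regular modulo [I]. If not, some prime
    over [Q] misses all these elements, so it has growth at least [m]; a chain of length 3 ending
    there would give [S] growth [m + 3], above its number of variables. *)
Lemma high_ideal_nzd (Q : S -> Prop) : is_ideal Q ->
  (forall P, is_prime P -> subI Q P -> prime_chain (@zeroI S) P 3) ->
  exists2 q, Q q & nzd_mod I q.
Proof.
move=> hQ high; have [iota [iC flat]] := flat_projection.
case: (classic (exists2 b, b != 0 & Q (iota b))) => [[b nb hb]|h].
  exists (iota b) => // y hy.
  have nb' : nzd_mod (@zeroI B) b.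
    by move=> z /eqP; rewrite mulf_eq0 (negPf nb) => /eqP.
  have hy' : addI I (imageI iota (@zeroI B)) (iota b * y).
    by apply: addI_left => //; apply: spanI_ideal.
  have [y1 [y2 [hy1 hy2 ->]]] := flat _ _ (zeroI_ideal B) nb' y hy'.
  have -> : y2 = 0; last by rewrite addr0.
  apply: (hy2 (@zeroI S) (zeroI_ideal S)) => _ [z -> ->].
  by rewrite /zeroI rmorph0.
pose M s := exists2 b, b != 0 & s = iota b.
have [|||P [hP QP MP]] := prime_avoiding (@mpoly_noetherian K m.+2) (M := M) _ _ hQ.
- by exists 1; rewrite ?oner_eq0 ?rmorph1.
- by move=> _ _ [b nb ->] [c nc ->]; exists (b * c); rewrite ?mulf_neq0 ?rmorphM.
- by move=> _ [b nb ->] hb; apply: h; exists b.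
have gr : growth P m.
  apply: growth_subring iC _ => b hb; apply/eqP/negPn/negP => nb.
  by apply: (MP (iota b)) => //; exists b.
by have := growth_le (growth_chain (high P hP QP) gr); rewrite addn3 ltnn.
Qed.

Lemma chain_length_le P h : is_ideal P -> ~ P 1 -> prime_chain I P h -> (h <= m)%N.
Proof.
by move=> hP n1 /growth_chain /(_ (growth0 hP n1)) /(growth_regular2 reg).
Qed.

End CompleteIntersection.

Lemma mpoly_subring_ind n (R : comNzRingType) (C : {mpoly R[n]} -> Prop) :
  (forall c, C c%:MP) -> (forall i, C 'X_i) ->
  (forall p q, C p -> C q -> C (p + q)) -> (forall p q, C p -> C q -> C (p * q)) ->
  forall p, C p.
Proof.
move=> hC hX hD hM p; rewrite [p]mpolyE; elim/big_ind: _ => //; first by rewrite -mpolyC0.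
move=> k _; rewrite -mul_mpolyC; apply: (hM) => //; rewrite mpolyXE_id.
elim/big_ind: _ => [|q r|i _]; [by rewrite -mpolyC1|exact: hM|].
elim: (k i) => [|l IH]; first by rewrite expr0 -mpolyC1.
by rewrite exprS; apply: hM.
Qed.

(** * The regular sequence defining a point of affine space *)

Section CoordinatePoint.
Variables (K : fieldType) (n : nat) (c : 'I_n -> K).
Local Notation S := {mpoly K[n]}.

Definition point_gens : seq S := [seq 'X_i - (c i)%:MP | i <- enum 'I_n].

Lemma size_point_gens : size point_gens = n.
Proof. by rewrite size_map size_enum_ord. Qed.

Lemma nth_point_gens k (hk : (k < n)%N) :
  point_gens`_k = 'X_(Ordinal hk) - (c (Ordinal hk))%:MP.
Proof.
rewrite (nth_map (Ordinal hk)) ?size_enum_ord // (_ : nth _ _ _ = Ordinal hk) //.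
exact: (nth_ord_enum _ (Ordinal hk)).
Qed.

Lemma take_point_gensP k f : f \in take k point_gens ->
  exists2 i : 'I_n, (i < k)%N & f = 'X_i - (c i)%:MP.
Proof.
move=> /(nthP 0)[j]; rewrite size_take_min size_point_gens leq_min => /andP[jk jn] <-.
by exists (Ordinal jn); rewrite // nth_take // nth_point_gens.
Qed.

Lemma point_gens_eval f : f \in point_gens -> f.@[c] = 0.
Proof.
by move=> /mapP[i _ ->]; rewrite rmorphB /= mevalXU mevalC subrr.
Qed.

Definition partial_eval (k : nat) : S -> S :=
  mmap (@mpolyC n K) (fun i : 'I_n => if (i < k)%N then (c i)%:MP else 'X_i).
HB.instance Definition _ k := GRing.RMorphism.on (partial_eval k).

Lemma partial_evalC k a : partial_eval k a%:MP = a%:MP.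
Proof. by rewrite /partial_eval mmapC. Qed.

Lemma partial_evalX k i :
  partial_eval k 'X_i = if (i < k)%N then (c i)%:MP else 'X_i.
Proof. by rewrite /partial_eval mmapX mmap1U. Qed.

(** Conversely to the obvious inclusion, [p - partial_eval k p] is always in the ideal: this holds
    for variables and is stable under sums and products. The quotient thus embeds in a domain, where
    the next generator is nonzero. *)
Lemma partial_eval_kernel k p : genI (take k point_gens) p <-> partial_eval k p = 0.
Proof.
have hJ := genI_ideal (take k point_gens).
split=> [|h].
  apply: (genI_min (ideal_comap (partial_eval k) (zeroI_ideal _))) => _ /take_point_gensP[i hi ->].
  by rewrite /zeroI rmorphB /= partial_evalC partial_evalX hi subrr.
suff : genI (take k point_gens) (p - partial_eval k p) by rewrite h subr0.
elim/mpoly_subring_ind: p {h} => [a|i|p q hp hq|p q hp hq].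
- by rewrite partial_evalC subrr; apply: idl0.
- rewrite partial_evalX; case: ifP => hi; last by rewrite subrr; apply: idl0.
  apply: genI_mem; have := ltn_ord i; rewrite -{2}size_point_gens => hs.
  have -> : 'X_i - (c i)%:MP = (take k point_gens)`_i.
    rewrite nth_take // (nth_point_gens (ltn_ord i)).
    by rewrite (_ : Ordinal _ = i) //; apply: val_inj.
  by apply: mem_nth; rewrite size_take_min leq_min hi.
- by rewrite rmorphD opprD addrACA; apply: idlD.
- have -> : p * q - partial_eval k (p * q) =
      p * (q - partial_eval k q) + partial_eval k q * (p - partial_eval k p).
    by rewrite rmorphM /=; ring.
  by apply: idlD => //; apply: idlMl.
Qed.

Lemma point_gens_nzd k : (k < n)%N -> nzd_mod (genI (take k point_gens)) point_gens`_k.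
Proof.
move=> hk y /partial_eval_kernel; rewrite nth_point_gens rmorphM rmorphB /=.
rewrite partial_evalC partial_evalX ltnn => /eqP; rewrite mulf_eq0 => /orP[|/eqP].
  move=> /eqP/(congr1 (mcoeff U_(Ordinal hk))); rewrite mcoeffB mcoeff0 mcoeffC mcoeffXU eqxx.
  have -> : (U_(Ordinal hk) == 0 :> 'X_{1..n})%MM = false by apply/negbTE; rewrite mnm1_eq0.
  by rewrite mulr0 subr0 => /eqP; rewrite oner_eq0.
by move/partial_eval_kernel.
Qed.

Lemma point_gens_proper : ~ genI point_gens 1.
Proof.
move=> /(genI_min (ideal_comap (meval c) (zeroI_ideal _)) point_gens_eval).
by rewrite /zeroI rmorph1 => /eqP; rewrite oner_eq0.
Qed.

Lemma point_gens_regular : regular_sequence point_gens.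
Proof.
have e fs := addI_zeroI (genI_ideal (R := S) fs).
split; last by move/e; apply: point_gens_proper.
by move=> i; rewrite size_point_gens => hi x /e /(point_gens_nzd hi) /e.
Qed.

End CoordinatePoint.

Lemma prime_chain_drop (R : comNzRingType) (I P : R -> Prop) h k :
  (k <= h)%N -> prime_chain I P h -> prime_chain I P k.
Proof.
move=> kh [p [hp hs he]]; exists (fun i => p (h - k + i)%N); split.
- by move=> i ik; apply: hp; lia.
- by move=> i ik; rewrite addnS; apply: hs; lia.
- by rewrite subnK.
Qed.

Lemma imageI_genI (A B : comNzRingType) (phi : {rmorphism A -> B}) fs :
  eqI (imageI phi (genI fs)) (genI (map phi fs)).
Proof.
move=> y; split; last first.
  apply: genI_min; first exact: spanI_ideal.
  by move=> _ /mapP[f hf ->]; apply: spanI_mem; exists f => //; apply: genI_mem.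
apply: spanI_min; first exact: genI_ideal.
move=> _ [x hx ->]; have hJ := ideal_comap phi (genI_ideal (map phi fs)).
by apply: (genI_min hJ) hx => f hf; apply: genI_mem; apply: map_f.
Qed.

Section CohenMacaulay.
Variables (K : closedFieldType) (m : nat) (f g : {mpoly K[m.+2]}).
Hypothesis reg : regular_sequence [:: f; g].
Local Notation S := {mpoly K[m.+2]}.
Let I := genI [:: f; g].
Let hI : is_ideal I. Proof. exact: genI_ideal. Qed.

(** [M] is the ideal of a point [x]. The projection [c] of [x] to affine [m]-space is cut out by a
    regular sequence of length [m] in [B]; by flatness its image stays regular modulo [I], and it
    lies in [M]. Chains ending at [M] have length at most [m], so depth and height are both [m]. *)
Lemma ci_cohen_macaulay : cohen_macaulay_quot I.
Proof.
move=> M hM IM; have [x hx] := maximal_ideal_point hM.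
have [idM M1 _] := hM; have nS := @mpoly_noetherian K m.+2.
have [iota [iC flat]] := flat_projection reg.
pose c i := (iota 'X_i).@[x].
pose fs := map iota (point_gens c).
have sfs : size fs = m by rewrite size_map size_point_gens.
have fsM h : h \in fs -> M h.
  case/mapP => _ /mapP[i _ ->] ->; apply/hx.
  by rewrite rmorphB iC rmorphB /= mevalC subrr.
have regfs : regular_mod I fs.
  split; last first.
    move=> h; apply: M1; move: 1 h; apply: addI_min => //.
    exact: genI_min.
  move=> i; rewrite sfs => hi y.
  have eJ : eqI (addI I (genI (take i fs))) (addI I (imageI iota (genI (take i (point_gens c))))).
    move=> z; rewrite /fs -map_take; split; apply: addI_mono => // t; by rewrite imageI_genI.
  rewrite /fs (nth_map 0) ?size_point_gens // => /eJ h; apply/eJ; move: h.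
  apply: flat; [exact: genI_ideal|exact: point_gens_nzd].
have pM : is_prime M.
  split=> // y z /hx; rewrite mevalM => /eqP; rewrite mulf_eq0.
  by case/orP => /eqP h; [left|right]; apply/hx.
exists m; split; split.
- by exists fs.
- move=> hs rhs hsM; apply: (chain_length_le reg idM M1).
  exact: (prime_chain_regular nS hI rhs pM IM hsM).
- move=> P hP MP; have := prime_chain_regular nS hI regfs hP; rewrite sfs; apply.
    by move=> y /IM /MP.
  by move=> y /fsM /MP.
- move=> /(_ M pM (fun _ h => h)) /(chain_length_le reg idM M1).
  by rewrite ltnn.
Qed.

(** The variables form a regular sequence of length [m.+2], which is at least 3 exactly when [m] is
    positive. *)
Lemma irrelevant_prime_chain (P : S -> Prop) : (0 < m)%N -> is_prime P ->
  (forall i, P 'X_i) -> prime_chain (@zeroI S) P 3.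
Proof.
move=> m0 hP hX; apply: (@prime_chain_drop _ _ _ m.+2) => //.
have := prime_chain_regular (@mpoly_noetherian K _) (zeroI_ideal _)
  (point_gens_regular (fun _ : 'I_m.+2 => 0 : K)) hP.
rewrite size_point_gens; apply.
- by move=> _ ->; apply: idl0; apply: prime_ideal.
- by move=> _ /mapP[i _ ->]; rewrite mpolyC0 subr0.
Qed.

(** The colon ideal [(I : h)] contains all monomials of degree [k], so a prime over it contains
    every variable and has height at least 3. Hence [(I : h)] contains some [q] regular modulo [I],
    and [q * h] in [I] forces [h] in [I]. *)
Lemma ci_saturated : (0 < m)%N -> saturated I.
Proof.
move=> m0 h [k hk].
have hQ := colonI_ideal h hI.
have [P hP QP|q hq] := high_ideal_nzd reg hQ; last by apply; rewrite /colonI in hq.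
apply: irrelevant_prime_chain => // i; apply: (prime_exp (k := k) hP); apply: QP.
rewrite /colonI; have -> : 'X_i ^+ k = 'X_[U_(i) *+ k] :> S by rewrite -mpolyXn.
by apply: hk; rewrite mdegMn mdeg1 mul1n.
Qed.

Lemma ci_ACM d e : (0 < m)%N -> f \is d.-homog -> g \is e.-homog -> ACM I.
Proof.
move=> m0 hf hg; split; [|exact: ci_saturated|exact: ci_cohen_macaulay].
by apply: (genI_homogeneous (ds := nth 0%N [:: d; e])); case=> [|[|]].
Qed.

End CohenMacaulay.

Lemma ACM_eq (K : fieldType) n (I J : {mpoly K[n]} -> Prop) : eqI I J -> ACM I -> ACM J.
Proof.
move=> e; suff -> : J = I by [].
by apply: functional_extensionality => x; apply: propositional_extensionality; split=> /e.
Qed.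

(** * The Jacobian ideal of an arrangement *)

Lemma radicalI_of_primes (R : comNzRingType) (I : R -> Prop) x : noetherian R -> is_ideal I ->
  (forall P, is_prime P -> subI I P -> P x) -> radicalI I x.
Proof.
move=> nR hI h; apply: NNPP => nr.
have [|||P [hP IP MP]] := prime_avoiding nR (M := fun y => exists k, y = x ^+ k) _ _ hI.
- by exists 0%N.
- by move=> _ _ [k ->] [l ->]; exists (k + l)%N; rewrite exprD.
- by move=> _ [k ->] hk; apply: nr; exists k.
by apply: (MP x); [exists 1%N | exact: h].
Qed.

Lemma prime_prod (R : comNzRingType) (P : R -> Prop) (T : finType) (A : pred T) (F : T -> R) :
  is_prime P -> P (\prod_(i | A i) F i) -> exists2 i, A i & P (F i).
Proof.
move=> hP; elim/big_rec: _ => [|i x Ai IH]; first by case: hP.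
by case: hP => _ _ hM /hM[]; [exists i|].
Qed.

Section RegularPowers.
Variable R : idomainType.
Implicit Types f g h : R.

Lemma nzd_mod_power f g k : f != 0 -> nzd_mod (genI [:: f]) g -> nzd_mod (genI [:: f ^+ k]) g.
Proof.
move=> nf hg; elim: k => [|k IH] y.
  by move=> _; apply/genI1P; exists y; rewrite expr0 mulr1.
case/genI1P => u eu; have /hg/genI1P[y' ey] : genI [:: f] (g * y).
  by apply/genI1P; exists (u * f ^+ k); rewrite eu exprSr mulrA.
have /IH/genI1P[w ew] : genI [:: f ^+ k] (g * y').
  apply/genI1P; exists u; apply: (mulIf nf).
  by rewrite -[LHS]mulrA -ey eu exprSr mulrA.
by apply/genI1P; exists w; rewrite ey ew exprSr mulrA.
Qed.

(** [g ^ l] is still regular modulo [f ^ k]. A relation [h2 * y = z * h1] yields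
    [f ^ k * y = h1 * w1] and [g ^ l * y = h1 * w2], whence [g ^ l * w1 = f ^ k * w2]. So [f ^ k]
    divides [w1], and cancelling it shows that [h1] divides [y]. *)
Lemma regular_of_powers f g h1 h2 k l : regular_sequence [:: f; g] ->
  genI [:: h1; h2] (f ^+ k) -> genI [:: h1; h2] (g ^+ l) -> ~ genI [:: h1; h2] 1 ->
  regular_sequence [:: h1; h2].
Proof.
case/regular_sequence2P => hf hg _ /genI2P[al [be ef]] /genI2P[ga [de eg]] n1.
have nf : f != 0.
  by apply/eqP => f0; have /eqP := hf 1 ltac:(by rewrite f0 mul0r); rewrite oner_eq0.
have nfk : f ^+ k != 0 by rewrite expf_neq0.
have hgl := nzd_mod_power nf (k := k) (nzd_modX (k := l) hg).
(* If [h1] were 0, both powers would be multiples of [h2], and their regularity would make [h2] a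
   unit. *)
have n0 : h1 != 0.
  apply/eqP => h10; have /hgl/genI1P[w ew] : genI [:: f ^+ k] (g ^+ l * be).
    by apply/genI1P; exists de; rewrite ef eg h10 !mulr0 !add0r; ring.
  apply: n1; apply/genI2P; exists 0, w; rewrite mul0r add0r.
  by apply: (mulIf nfk); rewrite mul1r [RHS]mulrAC -ew {1}ef h10 mulr0 add0r.
apply/regular_sequence2P; split=> //.
  by move=> y /eqP; rewrite mulf_eq0 (negPf n0) => /eqP.
move=> y /genI1P[z ez].
pose w1 := al * y + be * z; pose w2 := ga * y + de * z.
have e1 : f ^+ k * y = h1 * w1.
  have -> : f ^+ k * y = al * h1 * y + be * (h2 * y) by rewrite ef; ring.
  by rewrite ez /w1; ring.
have e2 : g ^+ l * y = h1 * w2.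
  have -> : g ^+ l * y = ga * h1 * y + de * (h2 * y) by rewrite eg; ring.
  by rewrite ez /w2; ring.
have /hgl/genI1P[w ew] : genI [:: f ^+ k] (g ^+ l * w1).
  apply/genI1P; exists w2; apply: (mulfI n0).
  have -> : h1 * (g ^+ l * w1) = g ^+ l * (h1 * w1) by ring.
  rewrite -e1; have -> : g ^+ l * (f ^+ k * y) = f ^+ k * (g ^+ l * y) by ring.
  by rewrite e2; ring.
apply/genI1P; exists w; apply: (mulfI nfk); rewrite e1 ew; ring.
Qed.
End RegularPowers.

Section HomogeneousForms.
Variables (K : fieldType) (n : nat).
Local Notation S := {mpoly K[n]}.
Implicit Types p : S.

Lemma mderiv_homog p d i : p \is d.+1.-homog -> p^`M(i) \is d.-homog.
Proof.
move=> /dhomogP hp; apply/dhomogP => k; rewrite mcoeff_msupp mcoeff_deriv => hk.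
have : (k + U_(i))%MM \in msupp p.
  by rewrite mcoeff_msupp; apply: contra hk => /eqP->; rewrite mul0rn.
by move/hp; rewrite /= mdegD mdeg1 addn1 => -[].
Qed.

Lemma euler_homog p d : p \is d.-homog -> \sum_i 'X_i * p^`M(i) = p *+ d.
Proof.
move=> /dhomogP hp.
have -> : \sum_i 'X_i * p^`M(i) = \sum_(k <- msupp p) \sum_i p@_k *: ('X_i * 'X_[k]^`M(i)).
  rewrite exchange_big /=; apply: eq_bigr => i _.
  rewrite {1}[p]mpolyE raddf_sum mulr_sumr; apply: eq_bigr => k _.
  by rewrite /= mderivZ scalerAr.
rewrite [p in RHS]mpolyE -sumrMnl; apply: eq_big_seq => k hk.
rewrite -scaler_sumr scalerMnr; congr (_ *: _).
rewrite -(hp _ hk) /= mdegE -sumrMnr; apply: eq_bigr => i _.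
rewrite mderivX -scalerAr -scaler_nat.
case: (posnP (k i)) => [->|ki]; first by rewrite !scale0r.
rewrite -mpolyXD; congr (_ *: 'X_[_]).
by rewrite addmC submK //; apply/mnm_lepP => j; rewrite mnm1E; case: eqP => // <-.
Qed.

Lemma homog_ideal_irrelevant (I : S -> Prop) p d : is_ideal I -> (forall i, I 'X_i) ->
  p \is d.+1.-homog -> I p.
Proof.
move=> hI hX /dhomogP hp; rewrite [p]mpolyE big_seq; apply: idl_sum => // k hk.
rewrite -mul_mpolyC; apply: idlMl => //.
have [i hi] : exists i, (0 < k i)%N.
  apply: NNPP => h; have := hp _ hk; rewrite /= mdegE big1 // => i _.
  by apply/eqP; rewrite -leqn0 leqNgt; apply/negP => hi; apply: h; exists i.
rewrite mpolyXE_id (bigD1 i) //= -(prednK hi) exprS -mulrA; apply: idlMr => //.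
Qed.

Lemma irrelevant_power (I : S -> Prop) : (0 < n)%N -> is_ideal I ->
  (forall i, exists k, I ('X_i ^+ k)) -> exists k, forall u, mdeg u = k -> I 'X_[u].
Proof.
move=> n0 hI h.
pose e i := proj1_sig (constructive_indefinite_description _ (h i)).
have he i : I ('X_i ^+ e i) by rewrite /e; case: (constructive_indefinite_description _ _).
(* Pigeonhole: as [n] is positive, exponents all below the [e i] would add up to strictly less than
   this sum. *)
exists (\sum_i e i)%N => u hu.
have [i hi] : exists i, (e i <= u i)%N.
  apply: NNPP => hn; have lt i : (u i < e i)%N.
    by rewrite ltnNge; apply/negP => hi; apply: hn; exists i.
  move: hu; rewrite mdegE => hu.
  have : (\sum_i (u i).+1 <= \sum_i e i)%N by apply: leq_sum => i _; apply: lt.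
  rewrite -hu; under eq_bigr => i _ do rewrite -addn1.
  rewrite big_split /= sum_nat_const card_ord muln1.
  by rewrite -{2}[(\sum_i u i)%N]addn0 leq_add2l leqNgt n0.
rewrite mpolyXE_id (bigD1 i) //= -(subnK hi) exprD.
by apply: idlMr => //; apply: idlMl.
Qed.

Lemma prod_homog (T : finType) (A : pred T) (G : T -> S) d :
  (forall i, G i \is d.-homog) -> \prod_(i | A i) G i \is (#|A| * d).-homog.
Proof.
move=> hG; rewrite -sum_nat_const.
by elim/big_rec2: _ => [|i k p _ IH]; [exact: dhomog1|exact: dhomogM].
Qed.

Lemma mderiv_prod (T : finType) (G : T -> S) k :
  (\prod_i G i)^`M(k) = \sum_i (G i)^`M(k) * \prod_(j | j != i) G j.
Proof.
suff h (r : seq T) : uniq r -> (\prod_(i <- r) G i)^`M(k) =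
    \sum_(i <- r) (G i)^`M(k) * \prod_(j <- r | j != i) G j.
  by rewrite h ?index_enum_uniq.
elim: r => [|i r IH] /=; first by rewrite !big_nil -mpolyC1 mderivC.
case/andP => ir ur; rewrite !big_cons eqxx /= mderivM IH //; congr (_ * _ + _).
  rewrite big_seq_cond [RHS]big_seq_cond; apply: eq_bigl => j.
  by rewrite andbT; case jr: (j \in r) => //=; apply/esym; apply: contraNneq ir => <-.
rewrite mulr_sumr; apply: eq_big_seq => l hl; rewrite big_cons.
have -> : i != l by apply: contraNneq ir => ->.
by rewrite mulrCA.
Qed.
End HomogeneousForms.

Section Arrangement.
Variables (K : closedFieldType) (m d s : nat).
Hypotheses (hK : [pchar K] =i pred0) (m0 : (0 < m)%N) (hd : (0 < d)%N) (hs : (1 < s)%N).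
Local Notation S := {mpoly K[m.+2]}.
Variables (F P : S) (a b : 'I_s -> K) (G_ : 'I_s -> S).
Hypotheses (hF : F \is d.-homog) (hP : P \is d.-homog).
Hypothesis regFP : regular_sequence [:: F; P].
Hypothesis smoothFP : forall x : 'I_m.+2 -> K, F.@[x] = 0 -> P.@[x] = 0 ->
  (forall k l, (F^`M(k)).@[x] * (P^`M(l)).@[x] = (F^`M(l)).@[x] * (P^`M(k)).@[x]) ->
  forall i, x i = 0.
Hypothesis smoothG : forall i (x : 'I_m.+2 -> K), (G_ i).@[x] = 0 ->
  (forall k, ((G_ i)^`M(k)).@[x] = 0) -> forall i, x i = 0.
Hypothesis eG : forall i, G_ i = a i *: F + b i *: P.
Hypothesis det_neq0 : forall i j, i != j -> a i * b j - a j * b i != 0.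

Let Gx i := \prod_(j < s | j != i) G_ j.
Let G := \prod_(i < s) G_ i.
Let J := jacobian_ideal G.
Let H1 := \sum_(i < s) a i *: Gx i.
Let H2 := \sum_(i < s) b i *: Gx i.
Let IH := genI [:: H1; H2].
Let IFP := genI [:: F; P].

Let hJ : is_ideal J. Proof. exact: genI_ideal. Qed.
Let hIH : is_ideal IH. Proof. exact: genI_ideal. Qed.
Let hIFP : is_ideal IFP. Proof. exact: genI_ideal. Qed.
Let nS := @mpoly_noetherian K m.+2.

Lemma other_index (i : 'I_s) : exists j, j != i.
Proof.
have s0 : (0 < s)%N by apply: ltnW.
case: (eqVneq i (Ordinal s0)) => [->|h]; first by exists (Ordinal hs).
by exists (Ordinal s0); rewrite eq_sym.
Qed.

Lemma natr_neq0 k : (0 < k)%N -> (k%:R : K) != 0.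
Proof. by move/pcharf0P: hK => ->; rewrite -lt0n. Qed.

Lemma prod_split i : G = G_ i * Gx i.
Proof. by rewrite /G (bigD1 i). Qed.

Lemma mderiv_G k : G^`M(k) = F^`M(k) * H1 + P^`M(k) * H2.
Proof.
rewrite /G mderiv_prod !mulr_sumr -big_split /=; apply: eq_bigr => i _.
by rewrite eG mderivD !mderivZ mulrDl -!scalerAl -!scalerAr.
Qed.

Lemma relation_FP : H1 * F + H2 * P = G *+ s.
Proof.
rewrite !mulr_suml -big_split /=.
transitivity (\sum_(i < s) G); last by rewrite sumr_const card_ord.
apply: eq_bigr => i _; rewrite (prod_split i) [G_ i]eG mulrDl.
by rewrite -!scalerAl ![Gx i * _]mulrC.
Qed.

Lemma jacobian_mem k : J G^`M(k).
Proof. by apply: genI_mem; apply: (map_f (fun i => G^`M(i))); rewrite mem_enum. Qed.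

Lemma jacobian_min (I : S -> Prop) : is_ideal I -> (forall k, I G^`M(k)) -> subI J I.
Proof. by move=> hI h; apply: genI_min => // _ /mapP[k _ ->]. Qed.

Lemma jacobian_sub_H : subI J IH.
Proof.
by apply: jacobian_min => // k; apply/genI2P; exists F^`M(k), P^`M(k); rewrite mderiv_G.
Qed.

Lemma G_FP i : IFP (G_ i).
Proof. by apply/genI2P; exists (a i)%:MP, (b i)%:MP; rewrite !mul_mpolyC. Qed.

(** Cramer's rule with a nonzero constant determinant: two distinct members span the pencil. *)
Lemma FP_of_pair (I : S -> Prop) i j : is_ideal I -> i != j -> I (G_ i) -> I (G_ j) ->
  I F /\ I P.
Proof.
move=> hI ij hi hj; set D := a i * b j - a j * b i.
have D0 : D != 0 by apply: det_neq0.
have unscale q : I (D *: q) -> I q.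
  move=> h; rewrite -[q]scale1r -(mulVf D0) -scalerA -mul_mpolyC; exact: idlMl.
split; apply: unscale.
  have -> : D *: F = (b j)%:MP * G_ i - (b i)%:MP * G_ j.
    by rewrite /D !eG !mul_mpolyC -!mul_mpolyC mpolyCB !mpolyCM; ring.
  by apply: idlB => //; apply: idlMl.
have -> : D *: P = (a i)%:MP * G_ j - (a j)%:MP * G_ i.
  by rewrite /D !eG !mul_mpolyC -!mul_mpolyC mpolyCB !mpolyCM; ring.
by apply: idlB => //; apply: idlMl.
Qed.

Lemma H_sub_FP : subI IH IFP.
Proof.
have hx i : IFP (Gx i).
  have [j ji] := other_index i; rewrite /Gx (bigD1 j) //=.
  by apply: idlMr => //; apply: G_FP.
apply: genI_min => // h; rewrite !inE => /orP[/eqP->|/eqP->];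
  by apply: idl_sum => // i _; rewrite -mul_mpolyC; apply: idlMl.
Qed.

Lemma H_proper : ~ IH 1.
Proof. by move=> /H_sub_FP; case/regular_sequence2P: regFP. Qed.

Lemma H_mod_G (I : S -> Prop) (c : 'I_s -> K) i : is_ideal I -> I (G_ i) ->
  I (\sum_(l < s) c l *: Gx l) -> I (c i *: Gx i).
Proof.
move=> hI hi; rewrite (bigD1 i) //= addrC => h.
suff hr : I (\sum_(l < s | l != i) c l *: Gx l) by apply/(idlDl _ hI hr).
apply: idl_sum => // l li; rewrite -mul_mpolyC /Gx (bigD1 i) 1?eq_sym //=.
by apply: idlMl => //; apply: idlMr.
Qed.

(** Once [G_ i] is in [Q], the elements [H1] and [H2] reduce to [a i] and [b i] times [Gx i]. These
    scalars are not both zero, so [Gx i] is in [Q] and yields the second factor. *)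
Lemma prime_H_FP (Q : S -> Prop) : is_prime Q -> Q H1 -> Q H2 -> Q F /\ Q P.
Proof.
move=> pQ h1 h2; have hQ := prime_ideal pQ; have [_ Q1 QM] := pQ.
have const c p : c != 0 -> Q (c *: p) -> Q p.
  move=> nc h; rewrite -[p]scale1r -(mulVf nc) -scalerA -mul_mpolyC; exact: idlMl.
have /(prime_prod pQ)[i _ Qi] : Q G.
  apply: (const s%:R); first by apply: natr_neq0; apply: ltnW.
  by rewrite scaler_nat -relation_FP; apply: idlD => //; apply: idlMr.
have [j ji] := other_index i.
have Qx : Q (Gx i).
  case: (eqVneq (a i) 0) => [a0|na]; last exact: const na (H_mod_G hQ Qi h1).
  case: (eqVneq (b i) 0) => [b0|nb]; last exact: const nb (H_mod_G hQ Qi h2).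
  by have := det_neq0 ji; rewrite a0 b0 mulr0 mul0r subrr eqxx.
have [l li Ql] := prime_prod pQ Qx.
exact: FP_of_pair li Ql Qi.
Qed.

Lemma FP_radical_H : exists k, IH (F ^+ k) /\ IH (P ^+ k).
Proof.
have rad q : (forall Q, is_prime Q -> subI IH Q -> Q q) -> radicalI IH q.
  exact: radicalI_of_primes.
have both Q : is_prime Q -> subI IH Q -> Q F /\ Q P.
  move=> pQ hQ; apply: prime_H_FP => //; apply: hQ; apply: genI_mem;
    by rewrite !inE eqxx ?orbT.
have [k hk] := rad F (fun Q pQ hQ => proj1 (both Q pQ hQ)).
have [l hl] := rad P (fun Q pQ hQ => proj2 (both Q pQ hQ)).
by exists (k + l)%N; rewrite !exprD; split; [apply: idlMr|apply: idlMl].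
Qed.

Lemma regH : regular_sequence [:: H1; H2].
Proof.
by have [k [hF' hP']] := FP_radical_H; apply: regular_of_powers regFP hF' hP' H_proper.
Qed.

Let G_homog i : G_ i \is d.-homog.
Proof. by rewrite eG; apply: dhomogD; apply: dhomogZ. Qed.

Lemma Gx_homog i : Gx i \is ((s - 1) * d).-homog.
Proof.
have := prod_homog (predC1 i) G_homog; rewrite cardC1 card_ord subn1.
by congr (_ \is _.-homog); apply: eq_bigl.
Qed.

Lemma H1_homog : H1 \is ((s - 1) * d).-homog.
Proof. by apply: rpred_sum => i _; apply: dhomogZ; apply: Gx_homog. Qed.

Lemma H2_homog : H2 \is ((s - 1) * d).-homog.
Proof. by apply: rpred_sum => i _; apply: dhomogZ; apply: Gx_homog. Qed.

Lemma G_prod_homog : G \is (s * d).-1.+1.-homog.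
Proof.
rewrite prednK ?muln_gt0 ?(ltnW hs) //.
by have := prod_homog predT G_homog; rewrite cardT size_enum_ord.
Qed.

Lemma jacobian_homogeneous : homogeneous_ideal J.
Proof.
apply: (genI_homogeneous (ds := fun _ => (s * d).-1)) => i.
rewrite size_map => hi; rewrite (nth_map ord0) //.
by apply: mderiv_homog; apply: G_prod_homog.
Qed.

Let C q := J (q * H1) /\ J (q * H2).

Let C_homogeneous : homogeneous_ideal C.
Proof.
have [c1 h1] := colonI_homogeneous H1_homog jacobian_homogeneous.
have [c2 h2] := colonI_homogeneous H2_homog jacobian_homogeneous.
split; last by move=> f [f1 f2] k; split; [exact: h1|exact: h2].
split.
- by split; [exact: (idl0 c1)|exact: (idl0 c2)].
- by move=> x y [x1 x2] [y1 y2]; split; [exact: (idlD c1)|exact: (idlD c2)].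
- by move=> z x [x1 x2]; split; [exact: (idlMl z c1)|exact: (idlMl z c2)].
Qed.

(* Off [Z] a common zero lies on one hypersurface [G_ i] only, so its gradient
   there is that of [G] up to a nonzero factor; on [Z] the minors of the
   Jacobian matrix of [(F, P)], which lie in [C] by Cramer's rule, decide.  *)
Lemma C_no_zero (x : 'I_m.+2 -> K) : (forall f, C f -> f.@[x] = 0) -> forall i, x i = 0.
Proof.
move=> hx; have CJ q : J q -> C q by move=> hq; split; apply: idlMr.
have dG k : (G^`M(k)).@[x] = 0 by apply: hx; apply: CJ; apply: jacobian_mem.
(* Euler's identity: the degree [s * d] of [G] is nonzero in [K], so [G] vanishes with its partial
   derivatives. *)
have /eqP : G.@[x] = 0.
  have /eqP := congr1 (meval x) (euler_homog G_prod_homog).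
  rewrite -scaler_nat mevalZ raddf_sum big1 /= => [|k _]; last first.
    by rewrite mevalM dG mulr0.
  by rewrite eq_sym mulf_eq0 (negPf (natr_neq0 _)) // => /eqP.
rewrite /G rmorph_prod prodf_seq_eq0 => /hasP[i _ /= /eqP Gi].
case: (classic (F.@[x] = 0 /\ P.@[x] = 0)) => [[Fx Px]|nFP].
  apply: smoothFP Fx Px _ => k l; apply/eqP; rewrite -subr_eq0 -!mevalM -rmorphB /=.
  apply/eqP/hx; split.
    have -> : (F^`M(k) * P^`M(l) - F^`M(l) * P^`M(k)) * H1 =
        P^`M(l) * G^`M(k) - P^`M(k) * G^`M(l) by rewrite !mderiv_G; ring.
    by apply: idlB => //; apply: idlMl => //; apply: jacobian_mem.
  have -> : (F^`M(k) * P^`M(l) - F^`M(l) * P^`M(k)) * H2 =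
      F^`M(k) * G^`M(l) - F^`M(l) * G^`M(k) by rewrite !mderiv_G; ring.
  by apply: idlB => //; apply: idlMl => //; apply: jacobian_mem.
have Gj j : j != i -> (G_ j).@[x] != 0.
  move=> ji; apply/eqP => h; apply: nFP.
  exact: (FP_of_pair (eval_kernel_ideal x) ji h Gi).
have Gxi : (Gx i).@[x] != 0.
  by rewrite /Gx rmorph_prod; apply/prodf_neq0 => j; apply: Gj.
apply: (smoothG Gi) => k; have := dG k.
rewrite (prod_split i) mderivM mevalD !mevalM Gi mul0r addr0 => /eqP.
by rewrite mulf_eq0 (negPf Gxi) orbF => /eqP.
Qed.

Let C_power i : exists k, C ('X_i ^+ k).
Proof. exact: (homogeneous_nullstellensatz C_homogeneous C_no_zero i). Qed.

Lemma C_irrelevant : exists k, forall u, mdeg u = k -> C 'X_[u].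
Proof. by apply: irrelevant_power => //; case: C_homogeneous. Qed.

(** One inclusion holds because [IH] is saturated and contains [J]; for the other, all monomials of
    some degree lie in [C], so they multiply [H1] and [H2] into [J]. *)
Lemma saturation_jacobian : eqI (saturation J) IH.
Proof.
move=> f; split=> [[k hk]|/genI2P[u [v ->]]].
  apply: (ci_saturated regH m0); exists k => w /hk; exact: jacobian_sub_H.
have [k hk] := C_irrelevant; exists k => w /hk[c1 c2].
have -> : 'X_[w] * (u * H1 + v * H2) = u * ('X_[w] * H1) + v * ('X_[w] * H2) by ring.
by apply: idlD => //; apply: idlMl.
Qed.

Lemma prime_jacobian Q : is_prime Q -> subI J Q -> (forall i, Q 'X_i) \/ (Q H1 /\ Q H2).
Proof.
move=> pQ hQ; case: (classic (forall i, Q 'X_i)) => [|hn]; [by left|right].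
have [i ni] : exists i, ~ Q 'X_i.
  by apply: NNPP => h; apply: hn => i; apply: NNPP => ni; apply: h; exists i.
have [k [c1 c2]] := C_power i; have [_ _ QM] := pQ.
have nk : ~ Q ('X_i ^+ k) by move/(prime_exp pQ).
by split; [case/hQ/QM: c1|case/hQ/QM: c2].
Qed.

Lemma radical_jacobian : subI IFP (radicalI J).
Proof.
have FPQ Q : is_prime Q -> subI J Q -> Q F /\ Q P.
  move=> pQ /(prime_jacobian pQ)[hX|[h1 h2]]; last exact: prime_H_FP.
  have hQ := prime_ideal pQ; have := hF; have := hP; rewrite -(prednK hd) => hP' hF'.
  by split; [apply: homog_ideal_irrelevant hF'|apply: homog_ideal_irrelevant hP'].
move=> q hq; apply: radicalI_of_primes => // Q pQ hQ; have [QF QP] := FPQ Q pQ hQ.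
apply: (genI_min (prime_ideal pQ)) hq => f; rewrite !inE => /orP[]/eqP-> //.
Qed.

Lemma prime_jacobian_chain2 Q : is_prime Q -> subI J Q -> prime_chain (@zeroI S) Q 2.
Proof.
move=> pQ /(prime_jacobian pQ)[hX|[h1 h2]].
  by apply: (@prime_chain_drop _ _ _ 3) => //; apply: irrelevant_prime_chain.
apply: (prime_chain_regular nS (zeroI_ideal _) regH pQ).
  by move=> _ ->; apply: idl0; apply: prime_ideal.
by move=> f; rewrite !inE => /orP[]/eqP->.
Qed.

(** All components have height at least 2, so the discarded ones have height at least 3. A component
    of height exactly 2 cannot contain powers of all variables, and cancelling a power of one of
    them puts [IH] inside it. Conversely, for [f] in [T] every prime over [(IH : f)] has height at
    least 3, and unmixedness applies. *)
Lemma top_jacobian T : is_top J T -> eqI T IH.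
Proof.
case=> r [Q [[pQ eQ] eT]] f; rewrite eT; split; last first.
  move=> hf i [_ n3]; have [hQ nQ1 QM] := pQ i.
  have [l nl] : exists l, ~ radicalI (Q i) 'X_l.
    apply: NNPP => h; apply: n3 => p pp Qp; apply: irrelevant_prime_chain => // l.
    have [k hk] : radicalI (Q i) 'X_l by apply: NNPP => nl; apply: h; exists l.
    by apply: (prime_exp (k := k) pp); apply: Qp.
  have [k [c1 c2]] := C_power l.
  have hq : Q i (f * 'X_l ^+ k).
    apply: (proj1 (eQ _)); case/genI2P: hf => u [v ->].
    have -> : (u * H1 + v * H2) * 'X_l ^+ k =
        u * ('X_l ^+ k * H1) + v * ('X_l ^+ k * H2) by ring.
    by apply: idlD => //; apply: idlMl.
  case: (QM _ _ hq) => // -[k' hk']; case: nl; exists (k * k')%N.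
  by rewrite exprM.
move=> hT; have hc := colonI_ideal f hIH.
have [p pp hp|q hq] := high_ideal_nzd regH hc; last by move=> /(_ f); apply.
case: (classic (exists i, ~ has_height (@zeroI S) (Q i) 2 /\ subI (Q i) p)) => [[i [n2 Qp]]|hn].
  have h2 : height_ge (@zeroI S) (Q i) 2.
    move=> p' pp' Qp'; apply: prime_jacobian_chain2 => // y /eQ /(_ i); exact: Qp'.
  have h3 : height_ge (@zeroI S) (Q i) 3 by apply: NNPP => n3; apply: n2.
  exact: h3.
(* No discarded component lies in [p]. Elements outside [p], taken inside the discarded components,
   have a product that multiplies [f] into [J]; this product would then lie in the prime [p]. *)
have hu i : exists u, ~ p u /\ (~ has_height (@zeroI S) (Q i) 2 -> Q i u).
  case: (classic (has_height (@zeroI S) (Q i) 2)) => [h|h].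
    by exists 1; split=> //; case: pp.
  apply: NNPP => nu; apply: hn; exists i; split=> // y hy; apply: NNPP => ny.
  by apply: nu; exists y.
pose u i := proj1_sig (constructive_indefinite_description _ (hu i)).
have [nu Qu] : (forall i, ~ p (u i)) /\ (forall i, ~ has_height (@zeroI S) (Q i) 2 -> Q i (u i)).
  by split=> i; rewrite /u; case: (constructive_indefinite_description _ _) => ? [].
have : p (\prod_i u i).
  apply: hp; apply: jacobian_sub_H; apply/eQ => i; have [hQ _ _] := pQ i.
  case: (classic (has_height (@zeroI S) (Q i) 2)) => [h|/Qu h].
    by apply: idlMl => //; apply: hT.
  by rewrite (bigD1 i) //=; apply: idlMr => //; apply: idlMr.
by case/(prime_prod pp) => i _ /nu.
Qed.

Lemma top_jacobian_exists : exists T, is_top J T.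
Proof.
have [r [Q hQ]] := primary_decomposition_exists nS hJ.
by exists (fun x => forall i, has_height (@zeroI S) (Q i) 2 -> Q i x), r, Q.
Qed.

Lemma ACM_H : ACM IH.
Proof. exact: (ci_ACM regH m0 H1_homog H2_homog). Qed.

Lemma ci_sequence_H : ci_sequence [:: ((s - 1) * d)%N; ((s - 1) * d)%N] [:: H1; H2].
Proof.
split; [exact: erefl| |exact: regH].
case=> [_|[_|]]; [exact: H1_homog|exact: H2_homog|by []].
Qed.

End Arrangement.

(** Vanishing minors make [(M ord_max k, - M ord0 k)] a left kernel vector for every column [k];
    independence of the rows then forces [M = 0]. *)
Lemma rank2_minor (K : fieldType) n (M : 'M[K]_(2, n)) : \rank M = 2%N ->
  ~ (forall k l, M ord0 k * M ord_max l = M ord0 l * M ord_max k).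
Proof.
move=> rM minors; have fM : row_free M by rewrite /row_free rM.
have M0 k : M ord_max k = 0 /\ M ord0 k = 0.
  pose v : 'rV[K]_2 := \row_i if i == ord0 then M ord_max k else - M ord0 k.
  have /eqP : v *m M = 0.
    apply/rowP => l; rewrite !mxE big_ord_recl big_ord1 !mxE /=.
    rewrite (_ : lift ord0 ord0 = ord_max); last exact: val_inj.
    by rewrite mulNr mulrC minors subrr.
  rewrite mulmx_free_eq0 // => /eqP/rowP v0.
  have := v0 ord0; have := v0 ord_max; rewrite !mxE /=.
  by move=> /eqP; rewrite oppr_eq0 => /eqP.
have : M = 0.
  apply/matrixP => i k; rewrite mxE; have [h1 h0] := M0 k.
  case: (eqVneq i ord0) => [-> //|ni]; rewrite (_ : i = ord_max) //.
  by apply: val_inj; case: i ni => [[|[|]]].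
by move: rM => /[swap] ->; rewrite mxrank0.
Qed.

Lemma regular_sequence1_neq0 (R : comNzRingType) (f : R) :
  regular_sequence [:: f] -> f != 0.
Proof.
case=> reg _; apply/eqP => f0.
have e x : addI (@zeroI R) (genI [::]) x <-> x = 0.
  by rewrite (addI_zeroI (genI_ideal _)) genI0P.
have /e/eqP := reg 0%N isT 1 ltac:(by apply/e; rewrite /= f0 mul0r).
by rewrite oner_eq0.
Qed.

Theorem theorem3p6 (K : closedFieldType) (hK : [pchar K] =i pred0)
  (n d s : nat) (hn : (2 <= n)%N) (hd : (1 <= d)%N) (hs : (2 <= s)%N)
  (F P : {mpoly K[n.+1]}) (Z : ('I_n.+1 -> K) -> Prop)
  (hZ : forall x, Z x <-> zero_locus [:: F; P] x)
  (hsmooth : smooth_ci [:: d; d] [:: F; P])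
  (hIZ : eqI (vanishing_ideal Z) (genI [:: F; P]))
  (G_ : 'I_s -> {mpoly K[n.+1]}) (a b : 'I_s -> K)
  (hGdeg : forall i, G_ i \is d.-homog)
  (hGZ : forall i, vanishing_ideal Z (G_ i))
  (hGsmooth : forall i, smooth_ci [:: d] [:: G_ i])
  (hGdistinct : forall i j, i != j ->
     ~ (forall x, zero_locus [:: G_ i] x <-> zero_locus [:: G_ j] x))
  (hGab : forall i, G_ i = a i *: F + b i *: P) :
  let G := \prod_(i < s) G_ i in
  let J := jacobian_ideal G in
                                                   
  let H1 := \sum_(i < s) a i *: \prod_(j < s | j != i) G_ j in
  let H2 := \sum_(i < s) b i *: \prod_(j < s | j != i) G_ j in
  [/\ exists ds, ci_ideal ds (saturation J),
      (exists T, is_top J T) /\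
        (forall T, is_top J T -> eqI T (saturation J) /\ ACM T),
      ACM (saturation J),
      eqI (radicalI J) (vanishing_ideal Z) /\ ACM (radicalI J)
    & ci_sequence [:: ((s - 1) * d)%N; ((s - 1) * d)%N] [:: H1; H2] /\
      eqI (saturation J) (genI [:: H1; H2])].
Proof.
move=> G J H1 H2.
(* With [n = m.+1] there are [m.+2] variables, and [2 <= n] is [0 < m]. *)
case: n hn F P Z hZ hsmooth hIZ G_ hGdeg hGZ hGsmooth hGdistinct hGab @G @J @H1 @H2
  => [//|m] hm F P Z hZ [[_ hFP regFP] rkFP] hIZ G_ hGdeg hGZ hGsmooth hGdistinct hGab G J H1 H2.
have m0 : (0 < m)%N by [].
have hF : F \is d.-homog := hFP 0%N isT.
have hP : P \is d.-homog := hFP 1%N isT.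
have nonzero x : ~ (forall i, x i = 0 :> K) -> exists i : 'I_m.+2, x i != 0.
  move=> h; apply: NNPP => hn'; apply: h => i; apply/eqP/negPn/negP => ni.
  by apply: hn'; exists i.
have smoothFP (x : 'I_m.+2 -> K) : F.@[x] = 0 -> P.@[x] = 0 ->
    (forall k l, (F^`M(k)).@[x] * (P^`M(l)).@[x] = (F^`M(l)).@[x] * (P^`M(k)).@[x]) ->
    forall i, x i = 0.
  move=> Fx Px minors; apply: NNPP => /nonzero nx.
  have /rkFP/rank2_minor : zero_locus [:: F; P] x.
    by split=> // f; rewrite !inE => /orP[]/eqP->.
  by apply=> k l; rewrite !mxE.
have smoothG i (x : 'I_m.+2 -> K) : (G_ i).@[x] = 0 ->
    (forall k, ((G_ i)^`M(k)).@[x] = 0) -> forall i, x i = 0.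
  move=> Gx dG; apply: NNPP => /nonzero nx; have [_ rk] := hGsmooth i.
  have : zero_locus [:: G_ i] x by split=> // f; rewrite inE => /eqP->.
  move/rk; rewrite (_ : jacobian_mx _ _ = 0) ?mxrank0 //.
  by apply/matrixP => j k; rewrite !mxE; case: j => [[|//] /= _]; apply: dG.
(* If the determinant vanished, the nonzero forms [G_ i] and [G_ j] would be proportional and define
   the same hypersurface. *)
have det_neq0 i j : i != j -> a i * b j - a j * b i != 0.
  move=> ij; apply/negP; rewrite subr_eq0 => /eqP e; apply: (hGdistinct i j ij).
  have sub k l x : a k * b l = a l * b k ->
      zero_locus [:: G_ k] x -> zero_locus [:: G_ l] x.
    move=> ekl [nx zx]; split=> // f; rewrite inE => /eqP->.
    have Gk : a k * F.@[x] + b k * P.@[x] = 0.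
      by rewrite -!mevalZ -mevalD -hGab; apply: zx; rewrite inE.
    have : G_ k != 0.
      by have [[_ _ reg] _] := hGsmooth k; exact: regular_sequence1_neq0 reg.
    rewrite (hGab l) mevalD !mevalZ; case: (eqVneq (a k) 0) => [ak|nak].
      case: (eqVneq (b k) 0) => [bk|nbk _].
        by rewrite (hGab k) ak bk !scale0r addr0 eqxx.
      apply: (mulfI nbk); rewrite mulr0 -[RHS](mulr0 (b l)) -Gk.
      have -> : b k * (a l * F.@[x] + b l * P.@[x]) =
         a l * b k * F.@[x] + b l * b k * P.@[x] by ring.
      by rewrite -ekl; ring.
    move=> _; apply: (mulfI nak); rewrite mulr0 -[RHS](mulr0 (a l)) -Gk.
    have -> : a k * (a l * F.@[x] + b l * P.@[x]) =
       a l * a k * F.@[x] + a k * b l * P.@[x] by ring.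
    by rewrite ekl; ring.
  by move=> x; split; apply: sub.
have satJ := saturation_jacobian hK m0 hd hs hF hP regFP smoothFP smoothG hGab det_neq0.
have ACMH := ACM_H hK m0 hs hF hP regFP hGab det_neq0.
have ciH := ci_sequence_H hK hs hF hP regFP hGab det_neq0.
have ACMsat : ACM (saturation J) by apply: ACM_eq ACMH => x; split=> /satJ.
have radJ : eqI (radicalI J) (vanishing_ideal Z).
  move=> q; split=> [[k hk] x Zx|/hIZ hq]; last first.
    exact: (radical_jacobian hK hd hs hF hP smoothFP smoothG hGab det_neq0 hq).
  have /hIZ /(_ x Zx) : genI [:: F; P] (q ^+ k).
    by apply: (H_sub_FP hs hGab); apply: (jacobian_sub_H hGab).
  by rewrite rmorphXn /= => /eqP; rewrite expf_eq0 => /andP[_ /eqP].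
split.
- by exists [:: ((s - 1) * d)%N; ((s - 1) * d)%N]; exists [:: H1; H2].
- split; first exact: top_jacobian_exists.
  move=> T hT.
  have eT := top_jacobian hK m0 hd hs hF hP regFP smoothFP smoothG hGab det_neq0 hT.
  split; last by apply: ACM_eq ACMH => x; split=> /eT.
  by move=> x; rewrite eT; split=> /satJ.
- exact: ACMsat.
- split; first exact: radJ.
  apply: ACM_eq (ci_ACM regFP m0 hF hP) => x.
  by split=> [/hIZ/radJ|/radJ/hIZ].
- by split.
Qed.
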